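(* Let $(\mathfrak{g},\rho,V,\mathcal{V},B_0)$ be a standard pentad over a field $\mathfrak{k}$, let $L(\mathfrak{g},\rho,V,\mathcal{V},B_0)=\bigoplus_{n\in\mathbb{Z}}V_n$ be the graded Lie algebra associated with it, and let $\pi:\mathfrak{g}\otimes U\to U$ be a representation of $\mathfrak{g}$ on a vector space $U$ over $\mathfrak{k}$. Then the vector space $\tilde U^+=\bigoplus_{m\in\mathbb{Z}}U^+_m=\bigoplus_{m\ge0}U^+_m$ has the structure of a positively graded $L(\mathfrak{g},\rho,V,\mathcal{V},B_0)$-module whose representation is $\tilde\pi^+$.
   Context: All objects are over a field $\mathfrak{k}$ and may be infinite-dimensional. A representation of a Lie algebra $\mathfrak{l}$ on $W$ is written as a linear map $\mathfrak{l}\otimes W\to W$. A module $(\varpi,W)$, $W=\bigoplus_{m\ge0}W_m$, of a graded Lie algebra $\bigoplus_n\mathfrak{l}_n$ is positively graded if $\varpi(\mathfrak{l}_n\otimes W_m)\subset W_{n+m}$ for all $n,m$ (with $W_k=\{0\}$ for $k<0$). Standard pentad $(\mathfrak{g},\rho,V,\mathcal{V},B_0)$: $\mathfrak{g}$ is a non-zero Lie algebra with a non-degenerate invariant bilinear form $B_0$ ($B_0([a,b],c)=B_0(a,[b,c])$; not assumed symmetric), $\rho:\mathfrak{g}\otimes V\to V$ is a representation, $\mathcal{V}$ is a $\mathfrak{g}$-submodule of $\mathrm{Hom}(V,\mathfrak{k})$ with canonical representation $\varrho$ (so $\langle\rho(a\otimes v),\phi\rangle=-\langle v,\varrho(a\otimes\phi)\rangle$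 for the canonical pairing $\langle\cdot,\cdot\rangle$), such that (i) $\langle\cdot,\cdot\rangle$ restricted to $V\times\mathcal{V}$ is non-degenerate, (ii) there is a (necessarily unique) linear map $\Phi_\rho:V\otimes\mathcal{V}\to\mathfrak{g}$ with $B_0(a,\Phi_\rho(v\otimes\phi))=\langle\rho(a\otimes v),\phi\rangle$ for all $a,v,\phi$. Put $\Psi_\rho(\phi\otimes v):=-\Phi_\rho(v\otimes\phi)$. Associated graded Lie algebra $L(\mathfrak{g},\rho,V,\mathcal{V},B_0)=\bigoplus_{n}V_n$: $V_0:=\mathfrak{g}$, $V_1:=V$, $V_{-1}:=\mathcal{V}$, with canonical representations $\rho_0$ (adjoint), $\rho_1=\rho$, $\rho_{-1}=\varrho$. For $x\in V_1$, $y\in V_{-1}$ write $x(y):=\Phi_\rho(x\otimes y)$, $y(x):=\Psi_\rho(y\otimes x)$. Let $p_0(x\otimes a):=-\rho_1(a\otimes x)$, $q_0(y\otimes a):=-\rho_{-1}(a\otimes y)$ for $a\in V_0$. Define $p_1:V_1\otimes V_1\to\mathrm{Hom}(V_{-1},V_1)$ by $p_1(v\otimes u)(\eta)=\rho_1(v(\eta)\otimes u)-\rho_1(u(\eta)\otimes v)$ and $q_{-1}:V_{-1}\otimes V_{-1}\to\mathrm{Hom}(V_1,V_{-1})$ by $q_{-1}(\phi\otimes\psi)(\xi)=\rho_{-1}(\phi(\xi)\otimes\psi)-\rho_{-1}(\psi(\xi)\otimes\phi)$. For $i\ge2$, inductively, $V_i:=\mathrm{Im}\,p_{i-1}\subset\mathrm{Hom}(V_{-1},V_{i-1})$,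 $V_{-i}:=\mathrm{Im}\,q_{-i+1}\subset\mathrm{Hom}(V_1,V_{-i+1})$ with the canonical $\mathfrak{g}$-module structures $\rho_{i},\rho_{-i}$, and $p_i:V_1\otimes V_i\to\mathrm{Hom}(V_{-1},V_i)$, $p_i(v\otimes u)(\eta)=\rho_i(v(\eta)\otimes u)+p_{i-1}(v\otimes u(\eta))$; $q_{-i}:V_{-1}\otimes V_{-i}\to\mathrm{Hom}(V_1,V_{-i})$, $q_{-i}(\phi\otimes\psi)(\xi)=\rho_{-i}(\phi(\xi)\otimes\psi)+q_{-i+1}(\phi\otimes\psi(\xi))$. The Lie bracket satisfies, for $a\in V_0$, $x\in V_1$, $y\in V_{-1}$, $z_n\in V_n$: $[a,z_n]=\rho_n(a\otimes z_n)$; $[x,z_n]=p_n(x\otimes z_n)$ if $n\ge0$, $=-z_n(x)$ if $n\le-1$; $[y,z_n]=-z_n(y)$ if $n\ge1$, $=q_n(y\otimes z_n)$ if $n\le0$; and it is extended inductively ($i\ge1$) by $[p_i(x\otimes z_i),w]=[x,[z_i,w]]-[z_i,[x,w]]$, $[q_{-i}(y\otimes\omega_{-i}),w]=[y,[\omega_{-i},w]]-[\omega_{-i},[y,w]]$. It is a theorem that this is a well-defined graded Lie algebra ($[V_n,V_m]\subset V_{n+m}$, generated by $V_{-1}\oplus V_0\oplus V_1$). Spaces $U_m^+$: $U_0^+:=U$, $\pi_0^+:=\pi$, $r_0^+:V_1\otimes U_0^+\to\mathrm{Hom}(V_{-1},U_0^+)$, $r_0^+(x\otimes u)(\eta)=\pi_0^+([\eta,x]\otimes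 u)$. For $j\ge1$, inductively, $U_j^+:=\mathrm{Im}\,r_{j-1}^+\subset\mathrm{Hom}(V_{-1},U_{j-1}^+)$, a $\mathfrak{g}$-submodule with representation $\pi_j^+$, and $r_j^+:V_1\otimes U_j^+\to\mathrm{Hom}(V_{-1},U_j^+)$, $r_j^+(x\otimes u)(\eta)=\pi_j^+([\eta,x]\otimes u)+r_{j-1}^+(x\otimes u(\eta))$ (these are $\mathfrak{g}$-module homomorphisms). $U_{-j}^+:=\{0\}$ for $j\ge1$. Map $\tilde\pi^+:L(\mathfrak{g},\rho,V,\mathcal{V},B_0)\otimes\tilde U^+\to\tilde U^+$: it is given by $\tilde\pi^+(z_n\otimes u_m)=\pi^+_{n,m}(z_n\otimes u_m)$ for $z_n\in V_n$, $u_m\in U_m^+$, where $\pi^+_{n,m}:V_n\otimes U_m^+\to U_{n+m}^+$ are the linear maps with $\pi^+_{0,m}=\pi_m^+$; $\pi^+_{1,m}(x\otimes u)=r_m^+(x\otimes u)$ for $m\ge0$ and $0$ for $m\le-1$; $\pi^+_{-1,m}(y\otimes u)=u(y)$ for $m\ge1$ and $0$ for $m\le0$; and inductively for $i\ge1$, $\pi^+_{i+1,m}(p_i(x\otimes z_i)\otimes u)=\pi^+_{1,i+m}(x\otimes\pi^+_{i,m}(z_i\otimes u))-\pi^+_{i,m+1}(z_i\otimes\pi^+_{1,m}(x\otimes u))$ and $\pi^+_{-i-1,m}(q_{-i}(y\otimes\omega_{-i})\otimes u)=\pi^+_{-1,-i+m}(y\otimes\pi^+_{-i,m}(\omega_{-i}\otimes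 u))-\pi^+_{-i,m-1}(\omega_{-i}\otimes\pi^+_{-1,m}(y\otimes u))$ (these formulas give well-defined maps). $(\tilde\pi^+,\tilde U^+)$ is called the positive extension of $U$ with respect to the pentad. *)

(* Defs.v *)
From HB Require Import structures.
From mathcomp Require Import all_boot all_order all_algebra.
From mathcomp Require Import mathcomp_extra boolp classical_sets functions.
From mathcomp Require Import cardinality fsbigop.

Set Implicit Arguments.
Unset Strict Implicit.
Unset Printing Implicit Defensive.

Import GRing.Theory.
Local Open Scope classical_set_scope.
Local Open Scope ring_scope.

(* Full products of families of vector spaces; direct sums are the subspaces  *)
(* [direct_sum] below.                                                        *)
Definition dprod (k : fieldType) (I : Type) (M : I -> lmodType k) : Type :=
  forall i, M i.

Section DprodLmodule.
Variables (k : fieldType) (I : Type) (M : I -> lmodType k).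

HB.instance Definition _ := gen_eqMixin (dprod M).
HB.instance Definition _ := gen_choiceMixin (dprod M).

Let add (f g : dprod M) : dprod M := fun i => f i + g i.
Let opp (f : dprod M) : dprod M := fun i => - f i.
Let zero : dprod M := fun i => 0.
Let scale (c : k) (f : dprod M) : dprod M := fun i => c *: f i.

Let addA : associative add.
Proof. by move=> f g h; apply/functional_extensionality_dep => i; apply: addrA. Qed.
Let addC : commutative add.
Proof. by move=> f g; apply/functional_extensionality_dep => i; apply: addrC. Qed.
Let add0 : left_id zero add.
Proof. by move=> f; apply/functional_extensionality_dep => i; apply: add0r. Qed.
Let addN : left_inverse zero opp add.
Proof. by move=> f; apply/functional_extensionality_dep => i; apply: addNr. Qed.
HB.instance Definition _ := GRing.isZmodule.Build (dprod M) addA addC add0 addN.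

Let scaleA c d f : scale c (scale d f) = scale (c * d) f.
Proof. by apply/functional_extensionality_dep => i; apply: scalerA. Qed.
Let scale1 : left_id 1 scale.
Proof. by move=> f; apply/functional_extensionality_dep => i; apply: scale1r. Qed.
Let scaleDr : right_distributive scale +%R.
Proof. by move=> c f g; apply/functional_extensionality_dep => i; apply: scalerDr. Qed.
Let scaleDl f : {morph scale^~ f : c d / c + d}.
Proof. by move=> c d; apply/functional_extensionality_dep => i; apply: scalerDl. Qed.
HB.instance Definition _ :=
  GRing.Zmodule_isLmodule.Build k (dprod M) scaleA scale1 scaleDr scaleDl.

End DprodLmodule.

Section DirectSum.
Variables (k : fieldType) (I : choiceType) (M : I -> lmodType k).
Variable S : forall i, set (M i).

Definition direct_sum : set (dprod M) :=
  [set f | (forall i, S (f i)) /\ finite_set [set i | f i != 0]].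

Definition homogeneous (i : I) : set (dprod M) :=
  [set f | S (f i) /\ forall j, j != i -> f j = 0].

End DirectSum.

Record lieAlgebra (k : fieldType) := LieAlgebra {
  lie_sort :> lmodType k;
  lie_bracket : {bilinear lie_sort -> lie_sort -> lie_sort};
  lie_alternating : forall a, lie_bracket a a = 0;
  lie_jacobi : forall a b c,
    lie_bracket a (lie_bracket b c) + lie_bracket b (lie_bracket c a)
      + lie_bracket c (lie_bracket a b) = 0
}.

(* [act] restricts to a representation, on the subspace [B] of [W], of the    *)
(* Lie algebra [A] (a subspace of [M]) with bracket [br].                     *)
Record is_lie_module (k : fieldType) (M W : lmodType k)
    (A : set M) (br : M -> M -> M) (B : set W) (act : M -> W -> W) : Prop := {
  lie_module_stable : forall z u, A z -> B u -> B (act z u);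
  lie_module_linearl : forall c z z' u, A z -> A z' -> B u ->
    act (c *: z + z') u = c *: act z u + act z' u;
  lie_module_linearr : forall c z u u', A z -> B u -> B u' ->
    act z (c *: u + u') = c *: act z u + act z u';
  lie_module_bracket : forall z w u, A z -> A w -> B u ->
    act (br z w) u = act z (act w u) - act w (act z u)
}.

Definition is_representation (k : fieldType) (l : lieAlgebra k)
    (W : lmodType k) (act : l -> W -> W) : Prop :=
  is_lie_module setT (lie_bracket l) setT act.

Record standardPentad (k : fieldType) := StandardPentad {
  pg : lieAlgebra k;
  pg_neq0 : exists a : pg, a != 0;
  pB0 : {bilinear pg -> pg -> k^o};
  pB0_nondegl : forall a, (forall b, pB0 a b = 0) -> a = 0;
  pB0_nondegr : forall b, (forall a, pB0 a b = 0) -> b = 0;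
  pB0_invariant : forall a b c,
    pB0 (lie_bracket pg a b) c = pB0 a (lie_bracket pg b c);
  pV : lmodType k;
  prho : pg -> pV -> pV;
  prho_rep : is_representation prho;
  (* the subspace [calV] of Hom(V, k), as a submodule of V -> k all of whose  *)
  (* elements are linear                                                      *)
  pdual_pred : pred (pV -> k^o);
  pdual : subLmodType pdual_pred;
  pdual_linear : forall phi : pdual, linear (\val phi : pV -> k^o);
  (* stability of [calV] under g, with the induced action                     *)
  pvarrho : pg -> pdual -> pdual;
  pvarrhoE : forall a phi v, \val (pvarrho a phi) v = - \val phi (prho a v);
  pairing_nondegl : forall v : pV,
    (forall phi : pdual, \val phi v = 0) -> v = 0;
  pairing_nondegr : forall phi : pdual,
    (forall v, \val phi v = 0) -> phi = 0;
  pPhi : {bilinear pV -> pdual -> pg};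
  pPhiE : forall a v phi, pB0 a (pPhi v phi) = \val phi (prho a v)
}.

(* hom_tower Y M i = Hom(Y, Hom(Y, ... Hom(Y, M))) with i arrows.  All maps,  *)
(* not only the linear ones, are allowed here: the modules of interest are    *)
(* spans of explicit linear maps in it, see [in_tower].                       *)
Fixpoint hom_tower (k : fieldType) (Y : Type) (M : lmodType k) (i : nat)
    : lmodType k :=
  if i is j.+1 then ((Y -> hom_tower Y M j) : lmodType k) else M.

Section Towers.
Variables (k : fieldType) (g X Y M : lmodType k).

Fixpoint tower_act (aM : g -> M -> M) (aY : g -> Y -> Y) (i : nat) (a : g)
    : hom_tower Y M i -> hom_tower Y M i :=
  match i return hom_tower Y M i -> hom_tower Y M i with
  | 0 => aM a
  | j.+1 => fun f eta => tower_act aM aY a (f eta) - f (aY a eta)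
  end.

Variable step : forall i, X -> hom_tower Y M i -> hom_tower Y M i.+1.

(* The spaces M, Im (step 0), Im (step 1), ..., where [step i] is only        *)
(* applied to elements of the i-th space; the image of the linear map on the  *)
(* tensor product is made of the finite sums of images of pure tensors.       *)
Fixpoint in_tower (i : nat) : set (hom_tower Y M i) :=
  match i return set (hom_tower Y M i) with
  | 0 => setT
  | j.+1 => [set z | exists s : seq (X * hom_tower Y M j),
      (forall t, t \in s -> in_tower t.2) /\
      z = \sum_(t <- s) step t.1 t.2]
  end.

Definition decompositions (i : nat) (z : hom_tower Y M i.+1) :
    set (seq (X * hom_tower Y M i)) :=
  [set s | (forall t, t \in s -> in_tower t.2) /\
           z = \sum_(t <- s) step t.1 t.2].

End Towers.

(* Extension of operators E x (x in X) to the spaces Im (step i) by           *)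
(*   step x z |-> E x \o (extension of z) - (extension of z) \o E x.          *)
(* The formula is applied to a chosen preimage under the linear map induced   *)
(* by [step i] on the tensor product.  In the two uses below (bracket of L    *)
(* and action on the positive extension) the result on the relevant graded    *)
(* space does not depend on the choice: this is the well-definedness of these *)
(* two maps.                                                                  *)
Fixpoint commutator_ext (k : fieldType) (X Y W : lmodType k)
    (step : forall i, X -> hom_tower Y X i -> hom_tower Y X i.+1)
    (E : X -> W -> W) (i : nat) : hom_tower Y X i -> W -> W :=
  match i return hom_tower Y X i -> W -> W with
  | 0 => E
  | j.+1 => fun z w =>
      \sum_(t <- xget [::] (decompositions step z))
        (E t.1 (commutator_ext step E t.2 w) -
         commutator_ext step E t.2 (E t.1 w))
  end.

Section AssociatedLieAlgebra.
Variables (k : fieldType) (P : standardPentad k).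
Local Notation g := (pg P).
Local Notation V := (pV P).
Local Notation dual := (pdual P).
Local Notation rho := (@prho k P).
Local Notation varrho := (@pvarrho k P).

(* x(y) *)
Definition ev_pos (x : V) (y : dual) : g := pPhi P x y.
(* y(x) *)
Definition ev_neg (y : dual) (x : V) : g := - pPhi P x y.

(* [p_map i] is p_(i+1) and [q_map i] is q_(-i-1). *)
Fixpoint p_map (i : nat) (v : V)
    : hom_tower dual V i -> hom_tower dual V i.+1 :=
  match i return hom_tower dual V i -> hom_tower dual V i.+1 with
  | 0 => fun u eta => rho (ev_pos v eta) u - rho (ev_pos u eta) v
  | j.+1 => fun u eta =>
      tower_act (i := j.+1) rho varrho (ev_pos v eta) u + p_map v (u eta)
  end.

Fixpoint q_map (i : nat) (phi : dual)
    : hom_tower V dual i -> hom_tower V dual i.+1 :=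
  match i return hom_tower V dual i -> hom_tower V dual i.+1 with
  | 0 => fun psi xi => varrho (ev_neg phi xi) psi - varrho (ev_neg psi xi) phi
  | j.+1 => fun psi xi =>
      tower_act (i := j.+1) varrho rho (ev_neg phi xi) psi + q_map phi (psi xi)
  end.

(* [Lspace n] is the ambient space of V_n; recall that Negz i is -(i+1).      *)
Definition Lspace (n : int) : lmodType k :=
  match n with
  | Posz 0 => g
  | Posz i.+1 => hom_tower dual V i
  | Negz i => hom_tower V dual i
  end.

Definition Lgrade (n : int) : set (Lspace n) :=
  match n return set (Lspace n) with
  | Posz 0 => setT
  | Posz i.+1 => in_tower p_map (i := i)
  | Negz i => in_tower q_map (i := i)
  end.

Definition Lambient : lmodType k := dprod Lspace.

(* The bracket operators [a, -], [x, -] and [y, -] for a, x, y in V_0, V_1,   *)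
(* V_-1, given by the component of degree n of the result.                    *)
Definition ad_zero (a : g) (w : Lambient) : Lambient := fun n =>
  match n return Lspace n with
  | Posz 0 => lie_bracket g a (w (Posz 0))
  | Posz i.+1 => tower_act (i := i) rho varrho a (w (Posz i.+1))
  | Negz i => tower_act (i := i) varrho rho a (w (Negz i))
  end.

Definition ad_pos (x : V) (w : Lambient) : Lambient := fun n =>
  match n return Lspace n with
  | Posz 0 => - ev_neg (w (Negz 0)) x
  | Posz 1 => - rho (w (Posz 0)) x
  | Posz i.+2 => p_map (i := i) x (w (Posz i.+1))
  | Negz i => - (w (Negz i.+1) : V -> hom_tower V dual i) x
  end.

Definition ad_neg (y : dual) (w : Lambient) : Lambient := fun n =>
  match n return Lspace n with
  | Posz 0 => - ev_pos (w (Posz 1)) y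
  | Posz i.+1 => - (w (Posz i.+2) : dual -> hom_tower dual V i) y
  | Negz 0 => - varrho (w (Posz 0)) y
  | Negz i.+1 => q_map (i := i) y (w (Negz i))
  end.

Definition graded_ext (W : lmodType k) (E0 : g -> W -> W) (E1 : V -> W -> W)
    (Em1 : dual -> W -> W) (n : int) : Lspace n -> W -> W :=
  match n return Lspace n -> W -> W with
  | Posz 0 => E0
  | Posz i.+1 => commutator_ext p_map E1 (i := i)
  | Negz i => commutator_ext q_map Em1 (i := i)
  end.

Definition Lbracket (z w : Lambient) : Lambient :=
  \sum_(n \in [set n | z n != 0]) graded_ext ad_zero ad_pos ad_neg (z n) w.

Section PositiveExtension.
Variables (U : lmodType k) (pi : g -> U -> U).

(* [r_map m] is r_m^+; in the Lie algebra, [eta, x] = - x(eta). *)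
Fixpoint r_map (m : nat) (x : V)
    : hom_tower dual U m -> hom_tower dual U m.+1 :=
  match m return hom_tower dual U m -> hom_tower dual U m.+1 with
  | 0 => fun u eta => pi (- ev_pos x eta) u
  | j.+1 => fun u eta =>
      tower_act (i := j.+1) pi varrho (- ev_pos x eta) u + r_map x (u eta)
  end.

Definition Uspace (m : nat) : lmodType k := hom_tower dual U m.

Definition Ugrade (m : nat) : set (Uspace m) := in_tower r_map (i := m).

Definition Uambient : lmodType k := dprod Uspace.

(* The operators pi_(0,m), pi_(1,m), pi_(-1,m), for all m together.  The      *)
(* spaces of negative degree are zero, hence left out.                        *)
Definition act_zero (a : g) (u : Uambient) : Uambient := fun m =>
  tower_act (i := m) pi varrho a (u m).

Definition act_pos (x : V) (u : Uambient) : Uambient := fun m =>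
  match m return Uspace m with
  | 0 => 0
  | j.+1 => r_map (m := j) x (u j)
  end.

Definition act_neg (y : dual) (u : Uambient) : Uambient := fun m =>
  (u m.+1 : dual -> Uspace m) y.

Definition positive_extension (z : Lambient) (u : Uambient) : Uambient :=
  \sum_(n \in [set n | z n != 0]) graded_ext act_zero act_pos act_neg (z n) u.

End PositiveExtension.
End AssociatedLieAlgebra.

(* The pieces of the Lie algebra are the [S n] (n in Z), those of the module  *)
(* the [T m] (m >= 0).                                                        *)
Definition is_positively_graded_module (k : fieldType)
    (M : int -> lmodType k) (S : forall n, set (M n))
    (br : dprod M -> dprod M -> dprod M)
    (N : nat -> lmodType k) (T : forall m, set (N m))
    (act : dprod M -> dprod N -> dprod N) : Prop :=
  is_lie_module (direct_sum S) br (direct_sum T) act /\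
  forall (n : int) (m : nat) (z : dprod M) (u : dprod N),
    homogeneous S n z -> homogeneous T m u ->
    match (n + m%:Z)%R with
    | Posz j => homogeneous T j (act z u)
    | Negz _ => act z u = 0
    end.

(* Main.v *)
(* On the positive extension, let A(a), E(x), F(y) be the operators given by the
   elements a, x, y of degree 0, 1, -1.  They satisfy
     [A(a),E(x)] = E(ax),  [A(a),F(y)] = F(ay),  [E(x),F(y)] = A([x,y])
   straight from the construction of the spaces.  An element z of degree i >= 2
   is a map y |-> z(y) = [z,y] into the elements of degree i-1, so an operator
   T attached to z must satisfy [T,F(y)] = T_{z(y)} recursively, down to degree
   1.  The recursively chosen commutators satisfy this, and it determines T: an
   operator of positive degree commuting with all F(y) vanishes, because an
   element of U_m, m >= 1, is determined by its values at the y.  Hence the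
   action is independent of the choices, linear in z and compatible with
   brackets by elements of degree 0, 1, -1.  In negative degrees E and F
   exchange roles, and uniqueness holds because the operators E(x) generate the
   extension from its component U_0, which operators of negative degree kill.
   Compatibility with brackets by arbitrary elements of L follows by induction
   on iterated commutators from the Jacobi identity for operators; neither the
   Jacobi identity of L nor the independence of its bracket from the choices
   enters. *)
Require Import Defs.
From mathcomp Require Import all_boot all_order all_algebra.
From mathcomp Require Import boolp classical_sets functions.
From mathcomp Require Import cardinality fsbigop.

Set Implicit Arguments.
Unset Strict Implicit.
Unset Printing Implicit Defensive.

Import GRing.Theory.
Local Open Scope classical_set_scope.
Local Open Scope ring_scope.

(** * Sums in abelian groups, linear maps, subspaces and representations *)

Lemma addr_pull (M : zmodType) (a t r s : M) : r = t + s -> a + r = t + (a + s).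
Proof. by move=> ->; rewrite addrCA. Qed.

Lemma addr_cancel (M : zmodType) (a r s : M) :
  r = - a + s -> s = 0 -> a + r = 0.
Proof. by move=> -> ->; rewrite addr0 subrr. Qed.

Lemma addr_cancelN (M : zmodType) (a r s : M) :
  r = a + s -> s = 0 -> - a + r = 0.
Proof. by move=> -> ->; rewrite addr0 addNr. Qed.

(* Atoms are compared up to conversion: the same sum may be built from
   different paths through the hierarchy of structures. *)
Ltac pulled t r :=
  match r with
  | (?a + ?s)%R =>
      let _ := match goal with _ => unify t a end in
      constr:(erefl r : r = t + s)
  | (?a + ?s)%R => let p := pulled t s in constr:(addr_pull a p)
  | ?a =>
      let _ := match goal with _ => unify t a end in
      constr:(esym (addr0 a) : a = t + 0)
  end.

Ltac cancel_terms :=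
  rewrite ?addr0 ?add0r;
  match goal with
  | |- (- ?a + ?r)%R = _ =>
      let p := pulled a r in apply: (addr_cancelN p); cancel_terms
  | |- (?a + ?r)%R = _ =>
      let p := pulled (- a)%R r in apply: (addr_cancel p); cancel_terms
  | |- _ => try reflexivity
  end.

(** Decides equalities between signed sums: everything is moved to one side and each leading term is
    cancelled against an opposite term further on. *)
Ltac abel :=
  apply/eqP; rewrite -subr_eq0; apply/eqP;
  rewrite ?opprD ?opprK ?oppr0 ?addr0 ?add0r -?addrA; cancel_terms.

Section LinearMaps.
Variables (k : fieldType) (M N : lmodType k) (f : M -> N).
Hypothesis f_lin : linear f.

Lemma lin0 : f 0 = 0.
Proof. by have := f_lin (-1) 0 0; rewrite !scaleN1r !addNr. Qed.
Lemma linP c u : f (c *: u) = c *: f u.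
Proof. by have := f_lin c u 0; rewrite lin0 !addr0. Qed.
Lemma linD : {morph f : u v / u + v}.
Proof. by move=> u v; have := f_lin 1 u v; rewrite !scale1r. Qed.
Lemma linN : {morph f : u / - u}.
Proof. by move=> u; rewrite -!scaleN1r linP. Qed.
Lemma linB : {morph f : u v / u - v}.
Proof. by move=> u v; rewrite linD linN. Qed.
Lemma lin_sum I (r : seq I) (F : I -> M) :
  f (\sum_(i <- r) F i) = \sum_(i <- r) f (F i).
Proof. by apply: (big_morph f linD lin0). Qed.
End LinearMaps.

Section Subspaces.
Variables (k : fieldType) (M : lmodType k) (A : set M).
Definition subspace := A 0 /\ forall (c : k) u v, A u -> A v -> A (c *: u + v).
Hypothesis A_sub : subspace.
Lemma subspaceD u v : A u -> A v -> A (u + v).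
Proof. by move=> Au Av; have := A_sub.2 1 _ _ Au Av; rewrite scale1r. Qed.
Lemma subspaceZ c u : A u -> A (c *: u).
Proof. by move=> Au; have := A_sub.2 c _ _ Au A_sub.1; rewrite addr0. Qed.
Lemma subspaceN u : A u -> A (- u).
Proof. by rewrite -scaleN1r; apply: subspaceZ. Qed.
Lemma subspaceB u v : A u -> A v -> A (u - v).
Proof. by move=> Au Av; apply: subspaceD => //; apply: subspaceN. Qed.
Lemma subspace_sum (I : eqType) (r : seq I) (F : I -> M) :
  (forall i, i \in r -> A (F i)) -> A (\sum_(i <- r) F i).
Proof.
move=> AF; rewrite big_seq.
by apply: big_ind => //; [exact: A_sub.1|exact: subspaceD].
Qed.
End Subspaces.

Section Representation.
Variables (k : fieldType) (g : lieAlgebra k) (W : lmodType k).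
Variable act : g -> W -> W.
Local Notation br := (lie_bracket g).
Hypothesis act_rep : is_representation act.

Lemma rep_linl w : linear (act^~ w).
Proof. by move=> e a a'; apply: (lie_module_linearl act_rep). Qed.
Lemma rep_linr a : linear (act a).
Proof. by move=> e w w'; apply: (lie_module_linearr act_rep). Qed.
Lemma rep_br a a' w : act (br a a') w = act a (act a' w) - act a' (act a w).
Proof. by apply: (lie_module_bracket act_rep). Qed.
End Representation.

(** * Towers of Hom spaces *)

Section Tower.
Variables (k : fieldType) (g : lieAlgebra k) (X Y M : lmodType k).
Variables (aX : g -> X -> X) (aY : g -> Y -> Y) (aM : g -> M -> M).
(** One abstract tower covers the three families $V_i$, $V_{-i}$ and $U_m^+$: [c] is the pairing of
    X and Y with values in g, and [b] is the bottom step, evaluated at an element of Y. *)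
Variables (c : X -> Y -> g) (b : X -> M -> Y -> M).
Variable step : forall i, X -> hom_tower Y M i -> hom_tower Y M i.+1.
Variable act : forall i, g -> hom_tower Y M i -> hom_tower Y M i.
Hypothesis act0 : forall a (u : M), act (i := 0) a u = aM a u.
Hypothesis actS : forall i a (u : hom_tower Y M i.+1) y,
  act a u y = act a (u y) - u (aY a y).
Hypothesis aY_rep : is_representation aY.
Hypothesis aM_rep : is_representation aM.
Hypothesis c_linl : forall y, linear (c^~ y).
Hypothesis c_linr : forall x, linear (c x).
Hypothesis c_equiv : forall a x y,
  lie_bracket g a (c x y) = c (aX a x) y + c x (aY a y).
Hypothesis b_linX : forall u y, linear (fun x => b x u y).
Hypothesis b_linM : forall x y, linear (fun u => b x u y).
Hypothesis b_linY : forall x u, linear (b x u).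
Hypothesis b_equiv : forall a x u y,
  aM a (b x u y) = b (aX a x) u y + b x (aM a u) y + b x u (aY a y).
Hypothesis step0 : forall x (u : M) y, step (i := 0) x u y = b x u y.
Hypothesis stepS : forall i x (u : hom_tower Y M i.+1) y,
  step x u y = act (c x y) u + step x (u y).

Local Notation tow i := (@in_tower k X Y M step i).

Lemma act_linr i a : linear (@act i a).
Proof.
elim: i => [|i IH] e u v; first by rewrite !act0; exact: (rep_linr aM_rep).
apply/funext => y; rewrite actS.
rewrite -[(e *: u + v) y]/(e *: u y + v y) IH.
rewrite -[RHS]/(e *: act a u y + act a v y) !actS.
rewrite -[(e *: u + v) _]/(e *: u (aY a y) + v (aY a y)).
by rewrite scalerBr; abel.
Qed.

Lemma step_linr i x : linear (@step i x).
Proof.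
elim: i => [|i IH] e u v /=; apply/funext => y.
  rewrite -[RHS]/(e *: step x u y + step x v y) !step0; exact: b_linM.
rewrite -[RHS]/(e *: step x u y + step x v y) !stepS act_linr.
by rewrite -[(e *: u + v) y]/(e *: u y + v y) IH scalerDr; abel.
Qed.

Lemma step_in_tower i x u : tow i u -> tow i.+1 (step x u).
Proof.
move=> u_i; exists [:: (x, u)]; rewrite big_seq1; split=> // t.
by rewrite inE => /eqP ->.
Qed.

Lemma in_tower_subspace i : subspace (tow i).
Proof.
elim: i => [|i IH]; first by split=> *; exact: I.
split; first by exists [::]; rewrite big_nil.
move=> e _ _ [s [sP ->]] [s' [s'P ->]].
(* The scalar is absorbed in the second tensor factor, in which [step] is linear. *)
exists ([seq (t.1, e *: t.2) | t <- s] ++ s'); split.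
  move=> t; rewrite mem_cat => /orP[/mapP[t' /sP t's ->]|/s'P //].
  exact: subspaceZ.
rewrite big_cat big_map scaler_sumr; congr (_ + _).
by apply: eq_bigr => t _; rewrite (linP (@step_linr _ _)).
Qed.

(** These laws have to be proved together, since they depend on one another through the level below.
    Equivariance of the step, for instance, is what makes its image stable under g one level up. *)
Record tower_level i (z : hom_tower Y M i) : Prop := TowerLevel {
  tl_act_linl : linear (fun a : g => act a z);
  tl_act_br : forall a a',
    act (lie_bracket g a a') z = act a (act a' z) - act a' (act a z);
  tl_act_stable : forall a, tow i (act a z);
  tl_step_linl : linear (fun x : X => step x z);
  tl_step_equiv : forall a x,
    act (i := i.+1) a (step x z) = step (aX a x) z + step x (act a z);
  tl_eval : match i return hom_tower Y M i -> Prop with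
    | 0 => fun=> True
    | j.+1 => fun z =>
        linear (z : Y -> hom_tower Y M j) /\ forall y, tow j (z y)
    end z
}.

(** Induction on the level. An element of the next space is determined by its values, and these lie
    in the previous space, so the identities are checked after evaluation at y. Only stability is
    read off from a decomposition. *)
Lemma tower_levelP i (z : hom_tower Y M i) : tow i z -> tower_level z.
Proof.
elim: i z => [|i IH] z.
  move=> _; split=> //.
  - by move=> e a a'; rewrite !act0 (rep_linl aM_rep).
  - by move=> a a'; rewrite !act0 (rep_br aM_rep).
  - move=> e x x'; apply/funext => y.
    rewrite -[RHS]/(e *: step x z y + step x' z y) !step0; exact: b_linX.
  - move=> a x; apply/funext => y.
    rewrite -[RHS]/(step (aX a x) z y + step (i := 0) x (act a z) y) actS act0.
    by rewrite !step0 act0 b_equiv addrK.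
move=> z_tow; have [s [sP zE]] := z_tow.
have zyE y : z y = \sum_(t <- s) step t.1 t.2 y.
  by rewrite zE; elim: (s) => [|t r IHr]; rewrite ?big_nil ?big_cons // -IHr.
have zlin : linear (z : Y -> hom_tower Y M i).
  have: forall t, t \in s -> linear (step t.1 t.2 : Y -> hom_tower Y M i).
    move=> t /sP /IH tP e y y'.
    case: i t tP {IH z z_tow s sP zE zyE} => [|i] t tP.
      by rewrite !step0; apply: b_linY.
    rewrite !stepS c_linr (tl_act_linl tP) (tl_eval tP).1 step_linr scalerDr.
    by rewrite -!addrA; congr (_ + _); rewrite addrCA.
  move=> slin e y y'; rewrite !zyE scaler_sumr -big_split big_seq [RHS]big_seq.
  by apply: eq_bigr => t /slin ->.
have zy_tow y : tow i (z y).
  (* Above level 0, the value of [step x u] at y is [act (c x y) u + step x (u y)], and both terms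
     stay in the space of u. *)
  rewrite zyE; apply: (subspace_sum (in_tower_subspace i)) => t /sP t_tow.
  case: i t t_tow {z z_tow s sP zE zyE zlin} IH => [|i] t t_tow IH //.
  have tP := IH _ t_tow.
  rewrite stepS; apply: (subspaceD (in_tower_subspace i.+1)).
    exact: tl_act_stable tP _.
  by apply: step_in_tower; apply: (tl_eval tP).2.
have act_linl : linear (fun a => act (a : g) z).
  move=> e a a'; apply/funext => y.
  rewrite -[RHS]/(e *: (act a z y) + act a' z y) !actS.
  rewrite (tl_act_linl (IH _ (zy_tow y))) (rep_linl aY_rep) zlin scalerBr; abel.
have act_br a a' : act (lie_bracket g a a') z =
    act a (act a' z) - act a' (act a z).
  apply/funext => y.
  rewrite -[RHS]/(act a (act a' z) y - act a' (act a z) y) !actS.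
  rewrite (tl_act_br (IH _ (zy_tow y))) (rep_br aY_rep).
  by rewrite (linB zlin) !(linB (@act_linr i _)); abel.
split=> //.
- move=> a.
  (* The witness is the Leibniz rule on tensors: a acts on each factor in turn. *)
  exists ([seq (aX a t.1, t.2) | t <- s] ++ [seq (t.1, act a t.2) | t <- s]).
  split.
    move=> t; rewrite mem_cat => /orP[]/mapP[t' /sP t_tow ->] //=.
    exact: tl_act_stable (IH _ t_tow) _.
  rewrite big_cat /= !big_map /= zE. rewrite -big_split /=.
  rewrite -[LHS]/(act a _) (lin_sum (@act_linr i.+1 a)) big_seq [RHS]big_seq.
  by apply: eq_bigr => t /sP/IH tP; rewrite (tl_step_equiv tP).
- move=> e x x'; apply/funext => y.
  rewrite -[RHS]/(e *: step x z y + step x' z y) !stepS c_linl act_linl.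
  rewrite (tl_step_linl (IH _ (zy_tow y))) scalerDr; abel.
- move=> a x; apply/funext => y.
  rewrite -[RHS]/(step (aX a x) z y + step x (act a z) y) actS !stepS.
  rewrite actS (linD (@act_linr _ a)) (linB (@step_linr _ _)).
  rewrite (tl_step_equiv (IH _ (zy_tow y))).
  (* The remaining discrepancy is the action of [a, c(x, y)] on z, computed once as a commutator and
     once through the equivariance of [c]. *)
  have := act_br a (c x y); rewrite c_equiv (linD act_linl) => /eqP.
  rewrite -subr_eq0 => /eqP E.
  apply/eqP; rewrite -subr_eq0 -oppr_eq0 -E; apply/eqP.
  by abel.
Qed.

End Tower.

(** * Commutators of linear operators *)

Section Operators.
Variables (k : fieldType) (W : lmodType k).
Implicit Types (S T : W -> W).

Definition commutator S T : W -> W := fun w => S (T w) - T (S w).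

Lemma commutator_linear S T : linear S -> linear T -> linear (commutator S T).
Proof.
move=> Slin Tlin e u v; rewrite /commutator Tlin Slin Slin Tlin scalerBr; abel.
Qed.

Lemma comb_linear e S T :
  linear S -> linear T -> linear (fun w => e *: S w + T w).
Proof.
move=> Slin Tlin a u v; rewrite Slin Tlin !scalerDr !scalerA (mulrC a); abel.
Qed.

Lemma zero_linear : linear (fun _ : W => 0 : W).
Proof. by move=> a u v; rewrite scaler0 addr0. Qed.

Variable G : set W.
Definition stable_on T := forall w, G w -> G (T w).

Lemma commutator_stable S T : subspace G ->
  stable_on S -> stable_on T -> stable_on (commutator S T).
Proof. by move=> Gs GS GT w Gw; apply: subspaceB => //; auto. Qed.
End Operators.

(** * Operators attached to the elements of a tower *)

Section TowerOperators.
Variables (k : fieldType) (g : lieAlgebra k) (X Y W : lmodType k).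
Variables (aX : g -> X -> X) (aY : g -> Y -> Y) (c : X -> Y -> g).
Variable step : forall i, X -> hom_tower Y X i -> hom_tower Y X i.+1.
Variable act : forall i, g -> hom_tower Y X i -> hom_tower Y X i.
Hypothesis act0 : forall a (u : X), act (i := 0) a u = aX a u.
Hypothesis actS : forall i a (u : hom_tower Y X i.+1) y,
  act a u y = act a (u y) - u (aY a y).
Hypothesis step0 : forall x (u : X) y,
  step (i := 0) x u y = aX (c x y) u - aX (c u y) x.
Hypothesis stepS : forall i x (u : hom_tower Y X i.+1) y,
  step x u y = act (c x y) u + step x (u y).

Variables (G : set W) (A : g -> W -> W) (E : X -> W -> W) (F : Y -> W -> W).
Hypothesis G_sub : subspace G.
Hypothesis A_lin : forall a, linear (A a).
Hypothesis E_lin : forall x, linear (E x).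
Hypothesis F_lin : forall y, linear (F y).
Hypothesis A_stable : forall a, stable_on G (A a).
Hypothesis E_stable : forall x, stable_on G (E x).
Hypothesis F_stable : forall y, stable_on G (F y).
Hypothesis E_linl : forall w, G w -> linear (E^~ w).
Hypothesis AE : forall a x w, G w -> commutator (A a) (E x) w = E (aX a x) w.
Hypothesis AF : forall a y w, G w -> commutator (A a) (F y) w = F (aY a y) w.
Hypothesis EF : forall x y w, G w -> commutator (E x) (F y) w = A (c x y) w.

(* [represents i z T] says that T commutes with the operators F as an operator
   representing z has to. *)
Fixpoint represents i : hom_tower Y X i -> (W -> W) -> Prop :=
  match i return hom_tower Y X i -> (W -> W) -> Prop with
  | 0 => fun z T => forall w, G w -> T w = E z w
  | j.+1 => fun z T => forall y, represents (z y) (commutator T (F y))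
  end.

Lemma eq_represents i (z : hom_tower Y X i) S T :
  (forall w, G w -> S w = T w) -> represents z S -> represents z T.
Proof.
elim: i z S T => [|i IH] z S T ST Sz; first by move=> w Gw; rewrite -ST ?Sz.
move=> y; apply: IH (Sz y) => w Gw.
by rewrite /commutator !ST //; apply: F_stable.
Qed.

Lemma represents_comb i e (z z' : hom_tower Y X i) T T' :
  represents z T -> represents z' T' ->
  represents (e *: z + z') (fun w => e *: T w + T' w).
Proof.
elim: i z z' T T' => [|i IH] z z' T T' Tz T'z'.
  by move=> w Gw; rewrite Tz // T'z' // E_linl.
move=> y; apply: eq_represents (IH _ _ _ _ (Tz y) (T'z' y)) => w Gw.
by rewrite /commutator F_lin scalerBr; abel.
Qed.

Lemma represents0 i : represents (0 : hom_tower Y X i) (fun=> 0).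
Proof.
elim: i => [|i IH]; first by move=> w Gw; rewrite (lin0 (E_linl Gw)).
move=> y; apply: eq_represents IH => w Gw.
by rewrite /commutator (lin0 (F_lin _)) subr0.
Qed.

Lemma representsD i (z z' : hom_tower Y X i) T T' :
  represents z T -> represents z' T' ->
  represents (z + z') (fun w => T w + T' w).
Proof.
move=> Tz T'z'; rewrite -[z]scale1r.
by apply: eq_represents (represents_comb _ Tz T'z') => w _; rewrite scale1r.
Qed.

Lemma representsB i (z z' : hom_tower Y X i) T T' :
  represents z T -> represents z' T' ->
  represents (z - z') (fun w => T w - T' w).
Proof.
move=> Tz T'z'; rewrite addrC -scaleN1r.
apply: eq_represents (represents_comb _ T'z' Tz) => w _.
by rewrite scaleN1r addrC.
Qed.

Lemma represents_sum i (r : seq (X * hom_tower Y X i)) j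
    (z : X * hom_tower Y X i -> hom_tower Y X j) T :
  (forall t, t \in r -> represents (z t) (T t)) ->
  represents (\sum_(t <- r) z t) (fun w => \sum_(t <- r) T t w).
Proof.
elim: r => [|t r IH] Tz.
  rewrite big_nil; apply: eq_represents (represents0 _) => w _.
  by rewrite big_nil.
rewrite big_cons.
have Tzt := Tz t (mem_head _ _).
have Tzr : forall t', t' \in r -> represents (z t') (T t').
  by move=> t' t'r; apply: Tz; rewrite inE t'r orbT.
by apply: eq_represents (representsD Tzt (IH Tzr)) => w _; rewrite big_cons.
Qed.

(** Jacobi identity for operators: [[A,T],F] = [A,[T,F]] - [T,[A,F]], which matches the recursion
    [actS] term by term. *)
Lemma represents_act i (z : hom_tower Y X i) T a :
  linear T -> stable_on G T ->
  represents z T -> represents (act a z) (commutator (A a) T).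
Proof.
elim: i z T => [|i IH] z T Tlin TG Tz.
  move=> w Gw; rewrite act0 -AE // /commutator !Tz //; exact: A_stable.
move=> y; rewrite actS.
have TF_lin := commutator_linear Tlin (F_lin y).
have TF_stable := commutator_stable G_sub TG (@F_stable y).
have TF_act := IH _ _ TF_lin TF_stable (Tz y).
apply: eq_represents (representsB TF_act (Tz (aY a y))) => w Gw.
rewrite /commutator -!AF //; last exact: TG.
rewrite /commutator !(linB Tlin) !(linB (A_lin _)) !(linB (F_lin _)); abel.
Qed.

(** Jacobi identity again: [[E,T],F] = [[E,F],T] + [E,[T,F]] with [E(x),F(y)] = A(c(x,y)), which is
    the recursion [stepS]. At the bottom T agrees with E(z) on G, and the same identity gives the
    two terms of [step0]. *)
Lemma represents_step i (z : hom_tower Y X i) T x :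
  linear T -> stable_on G T ->
  represents z T -> represents (step x z) (commutator (E x) T).
Proof.
elim: i z T => [|i IH] z T Tlin TG Tz; move=> y.
  rewrite step0 => w Gw; rewrite /=.
  rewrite (linB (E_linl Gw)) -!AE // -[RHS]addrC.
  rewrite /commutator -!EF //; try exact: E_stable.
  rewrite /commutator ?(linB (E_lin _)) ?(linB (F_lin _)).
  have TE v : G v -> T v = E z v by exact: Tz.
  have Ew : G (E x w) by exact: E_stable.
  have Fw : G (F y w) by exact: F_stable.
  have EFw : G (E x (F y w)) by exact: E_stable.
  by rewrite !TE //; abel.
rewrite stepS.
have TF_lin := commutator_linear Tlin (F_lin y).
have TF_stable := commutator_stable G_sub TG (@F_stable y).
have T_act := represents_act (c x y) Tlin TG Tz.
have TF_step := IH _ _ TF_lin TF_stable (Tz y).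
apply: eq_represents (representsD T_act TF_step) => w Gw.
rewrite /commutator -!EF //; last exact: TG.
rewrite /commutator !(linB Tlin) !(linB (E_lin _)) !(linB (F_lin _)); abel.
Qed.

(* [deg i] is to be the class of operators homogeneous of the same degree as
   the elements of the i-th space of the tower. *)
Variable deg : nat -> (W -> W) -> Prop.
Hypothesis deg_comb : forall i e S T,
  deg i S -> deg i T -> deg i (fun w => e *: S w + T w).
Hypothesis deg0 : forall i, deg i (fun=> 0).
Hypothesis deg_E : forall x, deg 0 (E x).
Hypothesis deg_CA : forall i a T, deg i T -> deg i (commutator (A a) T).
Hypothesis deg_CE : forall i x T,
  linear T -> deg i T -> deg i.+1 (commutator (E x) T).
Hypothesis deg_CF : forall i y T,
  linear T -> deg i.+1 T -> deg i (commutator T (F y)).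
Hypothesis deg_faithful : forall i T, linear T -> stable_on G T -> deg i T ->
  (forall y w, G w -> commutator T (F y) w = 0) -> forall w, G w -> T w = 0.

(** The class in which [represents] determines an operator on G; it is closed under the
    constructions below. *)
Definition admissible i T := [/\ linear T, stable_on G T & deg i T].

Lemma admissible_comb i e S T : admissible i S -> admissible i T ->
  admissible i (fun w => e *: S w + T w).
Proof.
move=> [Sl SG Sd] [Tl TG Td]; split; [exact: comb_linear| |exact: deg_comb].
by move=> w Gw; apply: G_sub.2; auto.
Qed.

Lemma admissible0 i : admissible i (fun=> 0).
Proof.
by split; [exact: zero_linear|move=> w _; exact: G_sub.1|exact: deg0].
Qed.

Lemma admissible_act i a T :
  admissible i T -> admissible i (commutator (A a) T).
Proof.
move=> [Tl TG Td].
by split; [exact: commutator_linear|exact: commutator_stable|exact: deg_CA].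
Qed.

Lemma admissible_E i x T :
  admissible i T -> admissible i.+1 (commutator (E x) T).
Proof.
move=> [Tl TG Td].
by split; [exact: commutator_linear|exact: commutator_stable|exact: deg_CE].
Qed.

Lemma admissible_F i y T :
  admissible i.+1 T -> admissible i (commutator T (F y)).
Proof.
move=> [Tl TG Td].
by split; [exact: commutator_linear|exact: commutator_stable|exact: deg_CF].
Qed.

(** The difference of S and T is again admissible. By induction its commutators with all F(y) vanish
    on G, so it vanishes there by [deg_faithful]. *)
Lemma represents_unique i (z : hom_tower Y X i) S T :
  admissible i S -> admissible i T -> represents z S -> represents z T ->
  forall w, G w -> S w = T w.
Proof.
elim: i z S T => [|i IH] z S T Sg Tg Sz Tz.
  by move=> w Gw; rewrite Sz ?Tz.
have [dl dG dd] := admissible_comb (-1) Sg Tg.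
move=> w Gw; apply/eqP; rewrite eq_sym -subr_eq0 addrC -scaleN1r; apply/eqP.
apply: (deg_faithful dl dG dd) Gw => y v Gv.
have := IH _ _ _ (admissible_F y Sg) (admissible_F y Tg) (Sz y) (Tz y) _ Gv.
rewrite /commutator (F_lin y) !scaleN1r => e.
apply: etrans (subrr (T (F y v) - F y (T v))); rewrite -[X in _ = _ - X]e; abel.
Qed.

Local Notation ext := (commutator_ext step E).
Local Notation tow i := (@in_tower k X Y X step i).

Lemma decompositionP i (z : hom_tower Y X i.+1) : tow i.+1 z ->
  decompositions step z (xget [::] (decompositions step z)).
Proof. by move=> [s sP]; apply: (xgetPex [::]); exists s. Qed.

(** Any decomposition would do: each commutator [E(x), ext u] represents [step x u], and
    [represents] is additive. *)
Lemma commutator_ext_represents i (z : hom_tower Y X i) :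
  tow i z -> admissible i (ext z) /\ represents z (ext z).
Proof.
elim: i z => [|i IH] z; first by move=> _; split=> //; split.
move=> /decompositionP[]; set r := xget _ _ => rP zE.
have tP t : t \in r -> admissible i.+1 (commutator (E t.1) (ext t.2)) /\
    represents (step t.1 t.2) (commutator (E t.1) (ext t.2)).
  move=> /rP/IH[tg tr]; split; first exact: admissible_E.
  by case: tg => tl tG _; apply: represents_step.
rewrite -[ext z]/(fun w => \sum_(t <- r) commutator (E t.1) (ext t.2) w).
split; last by rewrite zE; apply: represents_sum => t /tP[].
elim: (r) tP => [|t s IHs] tP.
  by under [X in admissible _ X]funext do rewrite big_nil; exact: admissible0.
have [tg _] := tP t (mem_head _ _).
have sg :
    admissible i.+1 (fun w => \sum_(t <- s) commutator (E t.1) (ext t.2) w).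
  by apply: IHs => t' t's; apply: tP; rewrite inE t's orbT.
have := admissible_comb 1 tg sg; congr (admissible _ _).
by apply/funext => w; rewrite scale1r big_cons.
Qed.

Lemma tow_ext_admissible i (z : hom_tower Y X i) :
  tow i z -> admissible i (ext z).
Proof. by move=> /commutator_ext_represents[]. Qed.

Lemma tow_ext_represents i (z : hom_tower Y X i) :
  tow i z -> represents z (ext z).
Proof. by move=> /commutator_ext_represents[]. Qed.

Hypothesis tow_sub : forall i, subspace (tow i).

(** The decompositions chosen for the three elements are unrelated, so the sums cannot be compared
    term by term. Both sides represent the same element, and uniqueness concludes. The next three
    laws follow the same pattern. *)
Lemma tow_ext_linl i e (z z' : hom_tower Y X i) w :
  tow i z -> tow i z' -> G w ->
  ext (e *: z + z') w = e *: ext z w + ext z' w.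
Proof.
move=> zt z't Gw.
have zz't : tow i (e *: z + z') by apply: (tow_sub i).2.
have zz'g := admissible_comb e (tow_ext_admissible zt) (tow_ext_admissible z't).
apply: (represents_unique (tow_ext_admissible zz't) zz'g
  (tow_ext_represents zz't) _ Gw).
by apply: represents_comb; exact: tow_ext_represents.
Qed.

Lemma tow_ext_act i (z : hom_tower Y X i) a w :
  tow i z -> tow i (act a z) -> G w ->
  ext (act a z) w = commutator (A a) (ext z) w.
Proof.
move=> zt azt; apply: (represents_unique (tow_ext_admissible azt) _
  (tow_ext_represents azt)).
  exact/admissible_act/tow_ext_admissible.
have [zl zG _] := tow_ext_admissible zt.
by apply: represents_act => //; exact: tow_ext_represents.
Qed.

Lemma tow_ext_step i (z : hom_tower Y X i) x w : tow i z -> G w ->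
  ext (step x z : hom_tower Y X i.+1) w = commutator (E x) (ext z) w.
Proof.
move=> zt; have xzt : tow i.+1 (step x z).
  exists [:: (x, z)]; rewrite big_seq1; split=> // t.
  by rewrite inE => /eqP ->.
apply: (represents_unique (tow_ext_admissible xzt) _
  (tow_ext_represents xzt)).
  exact/admissible_E/tow_ext_admissible.
have [zl zG _] := tow_ext_admissible zt.
by apply: represents_step => //; exact: tow_ext_represents.
Qed.

Lemma tow_ext_eval i (z : hom_tower Y X i.+1) y w :
  tow i.+1 z -> tow i (z y) -> G w ->
  ext (z y) w = commutator (ext z) (F y) w.
Proof.
move=> zt zyt; apply: (represents_unique (tow_ext_admissible zyt) _
  (tow_ext_represents zyt)).
  exact/admissible_F/tow_ext_admissible.
exact: (tow_ext_represents zt y).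
Qed.

Hypothesis tow_act : forall i (z : hom_tower Y X i) a,
  tow i z -> tow i (act a z).
Hypothesis tow_eval : forall i (z : hom_tower Y X i.+1) y,
  tow i.+1 z -> tow i (z y).

Record extension_laws : Prop := ExtensionLaws {
  el_admissible : forall i (z : hom_tower Y X i), tow i z ->
    admissible i (ext z);
  el_linl : forall i e (z z' : hom_tower Y X i) w, tow i z -> tow i z' -> G w ->
    ext (e *: z + z') w = e *: ext z w + ext z' w;
  el_act : forall i a (z : hom_tower Y X i) w, tow i z -> G w ->
    ext (act a z) w = commutator (A a) (ext z) w;
  el_step : forall i x (z : hom_tower Y X i) w, tow i z -> G w ->
    ext (step x z : hom_tower Y X i.+1) w = commutator (E x) (ext z) w;
  el_eval : forall i y (z : hom_tower Y X i.+1) w, tow i.+1 z -> G w ->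
    ext (z y) w = commutator (ext z) (F y) w
}.

Lemma commutator_extP : extension_laws.
Proof.
split.
- exact: tow_ext_admissible.
- by move=> i e z z' w zt z't Gw; exact: tow_ext_linl.
- by move=> i a z w zt Gw; apply: tow_ext_act => //; exact: tow_act.
- by move=> i x z w zt Gw; exact: tow_ext_step.
- by move=> i y z w zt Gw; apply: tow_ext_eval => //; exact: tow_eval.
Qed.
End TowerOperators.

(* The tower over M = X; both halves of L are instances, with (X, Y) equal to
   (V_1, V_-1) for the positive half and to (V_-1, V_1) for the negative one. *)
Section LocalPair.
Variables (k : fieldType) (g : lieAlgebra k) (X Y : lmodType k).
Variables (aX : g -> X -> X) (aY : g -> Y -> Y) (c : X -> Y -> g).
Hypothesis aX_rep : is_representation aX.
Hypothesis aY_rep : is_representation aY.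
Hypothesis c_linl : forall y, linear (c^~ y).
Hypothesis c_linr : forall x, linear (c x).
Hypothesis c_equiv : forall a x y,
  lie_bracket g a (c x y) = c (aX a x) y + c x (aY a y).
Variable step : forall i, X -> hom_tower Y X i -> hom_tower Y X i.+1.
Variable act : forall i, g -> hom_tower Y X i -> hom_tower Y X i.
Hypothesis act0 : forall a (u : X), act (i := 0) a u = aX a u.
Hypothesis actS : forall i a (u : hom_tower Y X i.+1) y,
  act a u y = act a (u y) - u (aY a y).

(** The value at y of the bracket [x,u] of two elements of X, as forced by the Jacobi identity when
    z(y) = [z,y]; this is $p_1$ or $q_{-1}$. *)
Definition pair_step (x u : X) (y : Y) : X := aX (c x y) u - aX (c u y) x.

Hypothesis step0 : forall x (u : X) y, step (i := 0) x u y = pair_step x u y.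
Hypothesis stepS : forall i x (u : hom_tower Y X i.+1) y,
  step x u y = act (c x y) u + step x (u y).

Lemma pair_step_linl u y : linear (fun x => pair_step x u y).
Proof.
move=> e x x'; rewrite /pair_step c_linl (rep_linl aX_rep) (rep_linr aX_rep).
by rewrite scalerBr; abel.
Qed.

Lemma pair_step_linr x y : linear (fun u => pair_step x u y).
Proof.
move=> e u u'; rewrite /pair_step c_linl (rep_linl aX_rep) (rep_linr aX_rep).
by rewrite scalerBr; abel.
Qed.

Lemma pair_step_lin x u : linear (pair_step x u).
Proof.
by move=> e y y'; rewrite /pair_step !c_linr !(rep_linl aX_rep) scalerBr; abel.
Qed.

Lemma pair_step_equiv a x u y :
  aX a (pair_step x u y) =
  pair_step (aX a x) u y + pair_step x (aX a u) y + pair_step x u (aY a y).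
Proof.
have aXc v v' : aX a (aX (c v y) v') =
    aX (c v y) (aX a v') + (aX (c (aX a v) y) v' + aX (c v (aY a y)) v').
  by rewrite -(linD (rep_linl aX_rep v')) -c_equiv (rep_br aX_rep); abel.
by rewrite /pair_step (linB (rep_linr aX_rep a)) !aXc; abel.
Qed.

Lemma pair_levelP i (z : hom_tower Y X i) :
  in_tower step z -> tower_level aX step act z.
Proof.
by apply: (tower_levelP act0 actS aY_rep aX_rep c_linl c_linr c_equiv
  pair_step_linl pair_step_linr pair_step_lin pair_step_equiv step0 stepS).
Qed.

Lemma pair_act_linr i a : linear (@act i a).
Proof. exact: (act_linr act0 actS aX_rep). Qed.

Lemma pair_step_map_linr i x : linear (@step i x).
Proof. exact: (step_linr act0 actS aX_rep pair_step_linr step0 stepS). Qed.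

Lemma pair_tow_subspace i : subspace (in_tower step (i := i)).
Proof.
exact: (in_tower_subspace act0 actS aX_rep pair_step_linr step0 stepS).
Qed.
End LocalPair.

(** * The three towers of a standard pentad *)

Section PentadActions.
Variables (k : fieldType) (P : standardPentad k).
Local Notation g := (pg P).
Local Notation V := (pV P).
Local Notation dual := (pdual P).
Local Notation rho := (@prho k P).
Local Notation varrho := (@pvarrho k P).
Local Notation br := (lie_bracket g).

Lemma br_linr a : linear (br a).
Proof. exact: linearP. Qed.

Lemma varrho_rep : is_representation varrho.
Proof.
have vP (phi psi : dual) : (forall v, \val phi v = \val psi v) -> phi = psi.
  by move=> e; apply: val_inj; apply/funext.
have valE e (phi psi : dual) v :
    \val (e *: phi + psi) v = e *: \val phi v + \val psi v.
  by rewrite linearP.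
have valB (phi psi : dual) v : \val (phi - psi) v = \val phi v - \val psi v.
  by rewrite raddfB.
split=> //.
- move=> e a a' phi _ _ _; apply: vP => v.
  rewrite valE !pvarrhoE (rep_linl (@prho_rep k P)) pdual_linear scalerN; abel.
- move=> e a phi psi _ _ _; apply: vP => v.
  rewrite valE !pvarrhoE valE scalerN; abel.
- move=> a a' phi _ _ _; apply: vP => v.
  rewrite valB !pvarrhoE (rep_br (@prho_rep k P)) (linB (pdual_linear phi)).
  abel.
Qed.

Lemma ev_pos_linl y : linear (fun x => ev_pos x y : g).
Proof. exact: linearPl. Qed.
Lemma ev_pos_linr x : linear (fun y => ev_pos x y : g).
Proof. exact: linearP. Qed.
(** Both sides are tested against b in the form $B_0(b,\cdot)$, non-degenerate in its second
    argument. Invariance turns $B_0(b,[a,\cdot])$ into $B_0([b,a],\cdot)$, and the claim becomes the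
    bracket law of [rho] paired with y. *)
Lemma ev_pos_equiv a x y :
  br a (ev_pos x y) = ev_pos (rho a x) y + ev_pos x (varrho a y).
Proof.
apply/eqP; rewrite -subr_eq0; apply/eqP; apply: pB0_nondegr => b.
rewrite linearB linearD /= -pB0_invariant /ev_pos !pPhiE pvarrhoE.
rewrite (rep_br (@prho_rep k P)) (linB (pdual_linear y)).
by abel.
Qed.

Lemma ev_neg_linl x : linear (fun y => ev_neg y x : g).
Proof. by move=> e y y'; rewrite /ev_neg linearP scalerN opprD. Qed.
Lemma ev_neg_linr y : linear (fun x => ev_neg y x : g).
Proof. by move=> e x x'; rewrite /ev_neg linearPl scalerN opprD. Qed.
Lemma ev_neg_equiv a y x :
  br a (ev_neg y x) = ev_neg (varrho a y) x + ev_neg y (rho a x).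
Proof.
by rewrite (linN (br_linr a)) ev_pos_equiv opprD addrC.
Qed.

Lemma p_levelP i (z : hom_tower dual V i) : in_tower (@p_map k P) z ->
  tower_level rho (@p_map k P) (tower_act rho varrho) z.
Proof. by apply: (pair_levelP (@prho_rep k P) varrho_rep
  ev_pos_linl ev_pos_linr ev_pos_equiv). Qed.

Lemma p_act_linr i a :
  linear (tower_act rho varrho a : hom_tower dual V i -> _).
Proof. by apply: (pair_act_linr (aY := varrho) (@prho_rep k P)). Qed.

Lemma p_map_linr i x : linear (@p_map k P i x).
Proof.
by apply: (pair_step_map_linr (aY := varrho) (act := tower_act rho varrho)
  (@prho_rep k P) ev_pos_linl).
Qed.

Lemma p_tow_subspace i : subspace (in_tower (@p_map k P) (i := i)).
Proof.
by apply: (pair_tow_subspace (aY := varrho) (act := tower_act rho varrho)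
  (@prho_rep k P) ev_pos_linl).
Qed.

Lemma q_levelP i (z : hom_tower V dual i) : in_tower (@q_map k P) z ->
  tower_level varrho (@q_map k P) (tower_act varrho rho) z.
Proof. by apply: (pair_levelP varrho_rep (@prho_rep k P)
  ev_neg_linl ev_neg_linr ev_neg_equiv). Qed.

Lemma q_act_linr i a :
  linear (tower_act varrho rho a : hom_tower V dual i -> _).
Proof. by apply: (pair_act_linr (aY := rho) varrho_rep). Qed.

Lemma q_map_linr i x : linear (@q_map k P i x).
Proof.
by apply: (pair_step_map_linr (aY := rho) (act := tower_act varrho rho)
  varrho_rep ev_neg_linl).
Qed.

Lemma q_tow_subspace i : subspace (in_tower (@q_map k P) (i := i)).
Proof.
by apply: (pair_tow_subspace (aY := rho) (act := tower_act varrho rho)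
  varrho_rep ev_neg_linl).
Qed.

Section Extension.
Variables (U : lmodType k) (pi : g -> U -> U).
Hypothesis pi_rep : is_representation pi.

Definition r_base x (u : U) y : U := pi (- ev_pos x y) u.

(** The tower over U is built with the pairing [y,x] = -x(y): u(y) is the action of y on u, whereas
    z(y) = [z,y] in L. The pairing laws are therefore needed with the sign. *)
Lemma ev_posN_linl y : linear (fun x => - ev_pos x y : g).
Proof. by move=> e x x'; rewrite ev_pos_linl scalerN opprD. Qed.

Lemma ev_posN_linr x : linear (fun y => - ev_pos x y : g).
Proof. by move=> e y y'; rewrite ev_pos_linr scalerN opprD. Qed.

Lemma ev_posN_equiv a x y :
  br a (- ev_pos x y) = - ev_pos (rho a x) y - ev_pos x (varrho a y).
Proof. by rewrite (linN (br_linr a)) ev_pos_equiv opprD. Qed.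

Lemma r_base_linl u y : linear (fun x => r_base x u y).
Proof. by move=> e x x'; rewrite /r_base ev_posN_linl (rep_linl pi_rep). Qed.

Lemma r_base_linr x y : linear (fun u => r_base x u y).
Proof. exact: rep_linr pi_rep _. Qed.

Lemma r_base_lin x u : linear (r_base x u).
Proof. by move=> e y y'; rewrite /r_base ev_posN_linr (rep_linl pi_rep). Qed.

Lemma r_base_equiv a x u y :
  pi a (r_base x u y) =
  r_base (rho a x) u y + r_base x (pi a u) y + r_base x u (varrho a y).
Proof.
apply/eqP; rewrite addrAC -subr_eq -(rep_br pi_rep) ev_posN_equiv.
by rewrite (linD (rep_linl pi_rep u)).
Qed.

Lemma r_act_linr m a : linear (tower_act pi varrho a : hom_tower dual U m -> _).
Proof. by apply: (act_linr (aY := varrho) _ _ pi_rep). Qed.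

Lemma r_map_linr m x : linear (@r_map k P U pi m x).
Proof.
by apply: (step_linr (aY := varrho) (act := tower_act pi varrho)
  _ _ pi_rep r_base_linr).
Qed.

Lemma r_tow_subspace m : subspace (in_tower (@r_map k P U pi) (i := m)).
Proof.
by apply: (in_tower_subspace (aY := varrho) (act := tower_act pi varrho)
  _ _ pi_rep r_base_linr).
Qed.

Lemma r_levelP m (u : hom_tower dual U m) : in_tower (@r_map k P U pi) u ->
  tower_level rho (@r_map k P U pi) (tower_act pi varrho) u.
Proof.
by apply: (tower_levelP _ _ varrho_rep pi_rep ev_posN_linl ev_posN_linr
  ev_posN_equiv r_base_linl r_base_linr r_base_lin r_base_equiv).
Qed.
End Extension.
End PentadActions.

(** * Direct sums and sums over finite supports *)

Section DirectSums.
Variables (k : fieldType) (I : choiceType) (M : I -> lmodType k).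
Variable S : forall i, set (M i).
Hypothesis S_sub : forall i, subspace (@S i).

Lemma dprod_sum J (s : seq J) (f : J -> dprod M) i :
  (\sum_(j <- s) f j) i = \sum_(j <- s) f j i.
Proof. by elim: s => [|j s IH]; rewrite ?big_nil // !big_cons -IH. Qed.

Lemma direct_sum_subspace : subspace (direct_sum S).
Proof.
split.
  split=> [i|]; first exact: (S_sub i).1.
  by apply: sub_finite_set (finite_set0 _) => i /=; rewrite eqxx.
move=> e u v [Su finu] [Sv finv]; split=> [i|]; first exact: (S_sub i).2.
have finuv : finite_set ([set i | u i != 0] `|` [set i | v i != 0]).
  by rewrite finite_setU.
apply: sub_finite_set finuv => i /=; apply: contra_neqP => /not_orP[].
move=> /negP/negPn/eqP ui /negP/negPn/eqP vi.
by rewrite -[LHS]/(e *: u i + v i) ui vi scaler0 addr0.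
Qed.

Lemma homogeneous_direct_sum i f : homogeneous S i f -> direct_sum S f.
Proof.
move=> [Sfi f0]; split=> [j|].
  by case: (eqVneq j i) => [->//|/f0 ->]; exact: (S_sub j).1.
apply: sub_finite_set (finite_set1 i) => j /=; apply: contra_neqP => /eqP.
exact: f0.
Qed.

(** The list may exceed the support, so that one list can serve several vectors at once. *)
Definition covers (s : seq I) (f : dprod M) :=
  uniq s /\ forall i, f i != 0 -> i \in s.

(** The list found here is the exact support, hence no condition on F; a larger list requires F to
    vanish where f does, as in [covers_fsbig]. *)
Lemma coversP (f : dprod M) : finite_set [set i | f i != 0] ->
  exists2 s, covers s f & forall (W : lmodType k) (F : I -> W),
    \sum_(i \in [set i | f i != 0]) F i = \sum_(i <- s) F i.
Proof.
move=> /finite_seqP[s sE].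
have s_uniq := undup_uniq s; have ssE : [set i | f i != 0] = [set` undup s].
  by rewrite sE; apply/seteqP; split=> i /=; rewrite mem_undup.
exists (undup s); last by move=> W F; rewrite ssE -fsbig_seq.
by split=> // i fi; have : [set` undup s] i by rewrite -ssE.
Qed.

Lemma covers_fsbig (s : seq I) (f : dprod M) (W : lmodType k) (F : I -> W) :
  covers s f -> (forall i, f i = 0 -> F i = 0) ->
  \sum_(i \in [set i | f i != 0]) F i = \sum_(i <- s) F i.
Proof.
move=> [s_uniq sf] F0; apply: fsbig_fwiden => // i [_ /= /negP/negPn/eqP].
exact: F0.
Qed.
End DirectSums.

(** * Homogeneous operators on a product graded by the natural numbers *)

Section GradedOperators.
Variables (k : fieldType) (N : nat -> lmodType k).
Local Notation W := (dprod N).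
Implicit Types (S T : W -> W) (w : W) (d e : int).

(* For a linear map T this says that T is homogeneous of degree d. *)
Definition has_degree d T := forall w j,
  (forall m : nat, m%:Z + d = j%:Z -> w m = 0) -> T w j = 0.

Lemma has_degree_comb d (e : k) S T : has_degree d S -> has_degree d T ->
  has_degree d (fun w => e *: S w + T w).
Proof.
move=> Sd Td w j w0; rewrite -[LHS]/(e *: S w j + T w j) Sd // Td //.
by rewrite scaler0 addr0.
Qed.

Lemma has_degree_comp d e S T :
  has_degree d S -> has_degree e T -> has_degree (d + e) (S \o T).
Proof.
move=> Sd Te w j w0; apply: Sd => m mj; apply: Te => m' m'm; apply: w0.
by rewrite addrCA addrA addrC -mj -m'm; abel.
Qed.

Lemma has_degree_commutator d e f S T : d + e = f ->
  has_degree d S -> has_degree e T -> has_degree f (commutator S T).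
Proof.
move=> <- Sd Te w j w0.
rewrite -[LHS]/((S \o T) w j - (T \o S) w j) (has_degree_comp Sd Te) //.
by rewrite (has_degree_comp Te Sd) ?subr0 // addrC.
Qed.

(** The inclusion of one factor; the cast transports v along the equality m = j. *)
Definition single m (v : N m) : W := fun j =>
  if m =P j is ReflectT e then ecast j (N j) e v else 0.

Lemma single_same m (v : N m) : single v m = v.
Proof.
by rewrite /single; case: eqP => // e; rewrite (eq_irrelevance e erefl).
Qed.

Lemma single_other m (v : N m) j : m != j -> single v j = 0.
Proof. by rewrite /single; case: eqP. Qed.
End GradedOperators.

(** * Operators on the positive extension *)

Section ExtensionOperators.
Variables (k : fieldType) (P : standardPentad k).
Local Notation g := (pg P).
Local Notation V := (pV P).
Local Notation dual := (pdual P).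
Local Notation rho := (@prho k P).
Local Notation varrho := (@pvarrho k P).
Variables (U : lmodType k) (pi : g -> U -> U).
Hypothesis pi_rep : is_representation pi.

Local Notation W := (Uambient P U).
Local Notation A := (act_zero pi).
Local Notation E := (act_pos pi).
Local Notation F := (@act_neg k P U).
Local Notation r := (@r_map k P U pi).
(** The full product of the spaces $U_m^+$, without finiteness of the support: the identities
    between operators are checked degree by degree. *)
Local Notation G := [set w : W | forall m, in_tower r (w m)].

Lemma Ugraded_subspace : subspace G.
Proof.
split; first by move=> m; exact: (r_tow_subspace pi_rep m).1.
by move=> e u v Gu Gv m; apply: (r_tow_subspace pi_rep m).2.
Qed.

Lemma act_zero_lin a : linear (A a).
Proof.
by move=> e u v; apply/functional_extensionality_dep => m; exact: r_act_linr.
Qed.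

Lemma act_pos_lin x : linear (E x).
Proof.
move=> e u v; apply/functional_extensionality_dep => -[|m].
  by apply: esym; rewrite -[LHS]/(e *: 0 + 0 : U) scaler0 addr0.
exact: r_map_linr.
Qed.

Lemma act_neg_lin y : linear (F y).
Proof. by []. Qed.

Lemma act_zero_stable a : stable_on G (A a).
Proof. by move=> w Gw m; apply: tl_act_stable (r_levelP pi_rep (Gw m)) a. Qed.

Lemma act_pos_stable x : stable_on G (E x).
Proof. by move=> w Gw [|m] //; apply: step_in_tower; exact: Gw. Qed.

Lemma act_neg_stable y : stable_on G (F y).
Proof. by move=> w Gw m; apply: (tl_eval (r_levelP pi_rep (Gw m.+1))).2. Qed.

Lemma act_zero_linl w : G w -> linear (A^~ w).
Proof.
move=> Gw e a a'; apply/functional_extensionality_dep => m.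
exact: (tl_act_linl (r_levelP pi_rep (Gw m))).
Qed.

Lemma act_pos_linl w : G w -> linear (E^~ w).
Proof.
move=> Gw e x x'; apply/functional_extensionality_dep => -[|m].
  by apply: esym; rewrite -[LHS]/(e *: 0 + 0 : U) scaler0 addr0.
exact: (tl_step_linl (r_levelP pi_rep (Gw m))).
Qed.

Lemma act_neg_linl w : G w -> linear (F^~ w).
Proof.
move=> Gw e y y'; apply/functional_extensionality_dep => m.
exact: (tl_eval (r_levelP pi_rep (Gw m.+1))).1.
Qed.

Lemma act_zero_br a a' w : G w ->
  A (lie_bracket g a a') w = commutator (A a) (A a') w.
Proof.
move=> Gw; apply/functional_extensionality_dep => m.
exact: (tl_act_br (r_levelP pi_rep (Gw m))).
Qed.

Lemma act_zero_pos a x w : G w -> commutator (A a) (E x) w = E (rho a x) w.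
Proof.
move=> Gw; apply/functional_extensionality_dep => -[|m].
  by rewrite -[LHS]/(pi a 0 - 0) subr0 (lin0 (rep_linr pi_rep a)).
rewrite -[LHS]/(tower_act pi varrho (i := m.+1) a (r x (w m)) -
  r x (tower_act pi varrho a (w m))).
by rewrite (tl_step_equiv (r_levelP pi_rep (Gw m))) addrK.
Qed.

Lemma act_zero_neg a y w : commutator (A a) (F y) w = F (varrho a y) w.
Proof.
apply/functional_extensionality_dep => m.
set z := tower_act pi varrho a ((w m.+1 : dual -> Uspace P U m) y).
rewrite -[LHS]/(z - (z - (w m.+1 : dual -> Uspace P U m) (varrho a y))).
by rewrite opprB addrC subrK.
Qed.

(** The recursion defining [r_map] is this commutation relation, solved for the value of [r_map x u]
    at y. *)
Lemma act_pos_neg x y w : G w -> commutator (E x) (F y) w = A (ev_pos x y) w.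
Proof.
move=> Gw; apply/functional_extensionality_dep => -[|m].
  rewrite -[LHS]/(0 - pi (- ev_pos x y) (w 0)) sub0r.
  by rewrite (linN (rep_linl pi_rep (w 0))) opprK.
set z := r x ((w m.+1 : dual -> Uspace P U m) y).
rewrite -[LHS]/(z -
  (tower_act pi varrho (i := m.+1) (- ev_pos x y) (w m.+1) + z)).
rewrite (linN (tl_act_linl (r_levelP pi_rep (Gw m.+1)))) opprD opprK addrCA.
by rewrite subrr addr0.
Qed.

Lemma act_zero_degree a : has_degree 0 (A a).
Proof.
move=> w j w0; rewrite -[LHS]/(tower_act pi varrho a (w j)) w0 ?addr0 //.
exact: (lin0 (r_act_linr pi_rep a)).
Qed.

Lemma act_pos_degree x : has_degree 1 (E x).
Proof.
move=> w [|j] // w0; rewrite -[LHS]/(r x (w j)) w0; last by rewrite addrC.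
exact: (lin0 (r_map_linr pi_rep x)).
Qed.

Lemma act_neg_degree y : has_degree (-1) (F y).
Proof.
move=> w j w0; rewrite -[LHS]/((w j.+1 : dual -> Uspace P U j) y) w0 //.
by rewrite -addn1 PoszD addrK.
Qed.

(** Induction on the component of T w. Component 0 vanishes because T raises degrees; component m+1
    is a function whose value at y is component m of F(y) T w = T F(y) w. *)
Lemma positive_faithful i (T : W -> W) : has_degree i.+1%:Z T ->
  (forall y w, G w -> commutator T (F y) w = 0) -> forall w, G w -> T w = 0.
Proof.
move=> Td TF w Gw; apply/functional_extensionality_dep => m.
elim: m w Gw => [|m IH] w Gw; first by apply: Td => m'; rewrite -PoszD addnS.
apply/funext => y; rewrite -[LHS]/(F y (T w) m).
have /eqP := TF y _ Gw; rewrite subr_eq0 => /eqP <-.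
by apply: IH; exact: act_neg_stable.
Qed.

(** T kills $U_0^+$ by degree and commutes with every E(x), and the elements E(x)u with u in $U_m^+$
    span $U_{m+1}^+$. *)
Lemma negative_faithful i (T : W -> W) : linear T -> has_degree (- i.+1%:Z) T ->
  (forall x w, G w -> commutator T (E x) w = 0) -> forall w, G w -> T w = 0.
Proof.
move=> Tl Td TE.
have TEw x w : G w -> T w = 0 -> T (E x w) = 0.
  move=> Gw Tw; have /eqP := TE x _ Gw; rewrite /commutator Tw.
  by rewrite (lin0 (act_pos_lin x)) subr0 => /eqP.
have single_G m (v : Uspace P U m) : in_tower r v -> G (single v).
  move=> vt j; case: (eqVneq m j) => [<-|mj]; first by rewrite single_same.
  by rewrite single_other //; exact: (r_tow_subspace pi_rep j).1.
have T1 m (v : Uspace P U m) : in_tower r v -> T (single v) = 0.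
  elim: m v => [|m IH] v vt.
    apply/functional_extensionality_dep => j; apply: Td => m' m'j.
    by rewrite single_other //; case: m' m'j => // m'; case: i Td => [|i] Td.
  have [s [sP vE]] := vt.
  have -> : single v = \sum_(t <- s) E t.1 (single t.2).
    apply/functional_extensionality_dep => j.
    rewrite dprod_sum; case: (eqVneq m.+1 j) => [jE|mj].
      case: j / jE; rewrite single_same vE.
      apply: eq_bigr => t _.
      by rewrite -[RHS]/(r t.1 (single t.2 m)) single_same.
    rewrite single_other // big1 // => t _; case: j mj => // j mj.
    rewrite -[LHS]/(r t.1 (single t.2 j)) single_other //.
    exact: (lin0 (r_map_linr pi_rep _)).
  rewrite (lin_sum Tl) big_seq big1 // => t /sP tt.
  by apply: TEw; [exact: single_G|exact: IH].
move=> w Gw; apply/functional_extensionality_dep => j.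
(* Infinitely many components of w may be non-zero, but component j of T w depends only on the
   component of w of degree j + i + 1, which is split off. *)
have -> : w = (w - single (w (j + i.+1)%N)) + single (w (j + i.+1)%N).
  by rewrite subrK.
rewrite (linD Tl) T1 // addr0; apply: Td => m mj.
have -> : m = (j + i.+1)%N.
  by apply/eqP; rewrite -eqz_nat PoszD -mj subrK.
by rewrite -[LHS]/(w _ - single _ _) single_same subrr.
Qed.
End ExtensionOperators.

Lemma has_degree_finite (k : fieldType) (N : nat -> lmodType k) d
    (T : dprod N -> dprod N) w : has_degree d T ->
  finite_set [set m | w m != 0] -> finite_set [set m | T w m != 0].
Proof.
(* The support of T w lies in the translate by d of that of w; the absolute value only serves to
   land in the natural numbers. *)
move=> Td /(finite_image (fun m : nat => `|(m%:Z + d)%R|%N)) finw.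
apply: sub_finite_set finw.
move=> j /=; apply: contra_neqP => nex; apply: Td => m mj; apply/eqP.
by apply: contra_notT nex => wm; exists m; rewrite ?mj.
Qed.

(* Both extensions of z use the same chosen decomposition, so only the Jacobi
   identity for operators on W is needed. *)
Section CommutatorExtensions.
Variables (k : fieldType) (X Y L W : lmodType k).
Variable step : forall i, X -> hom_tower Y X i -> hom_tower Y X i.+1.
Variables (ad : X -> L -> L) (E : X -> W -> W) (act : L -> W -> W).
Variables (DL : set L) (G : set W).
Hypothesis DL_sub : subspace DL.
Hypothesis act_linl : forall e l l' w, DL l -> DL l' -> G w ->
  act (e *: l + l') w = e *: act l w + act l' w.
Hypothesis act_linr : forall l, DL l -> linear (act l).
Hypothesis E_stable : forall x, stable_on G (E x).
Hypothesis E_lin : forall x, linear (E x).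
Hypothesis ad_stable : forall x, stable_on DL (ad x).
Hypothesis act_ad : forall x l w, DL l -> G w ->
  act (ad x l) w = commutator (E x) (act l) w.
Hypothesis extE_stable : forall i (z : hom_tower Y X i), in_tower step z ->
  stable_on G (commutator_ext step E z).
Hypothesis extE_lin : forall i (z : hom_tower Y X i), in_tower step z ->
  linear (commutator_ext step E z).

Lemma act_sum (J : eqType) (s : seq J) (l : J -> L) w :
  (forall j, j \in s -> DL (l j)) -> G w ->
  act (\sum_(j <- s) l j) w = \sum_(j <- s) act (l j) w.
Proof.
move=> ls Gw; elim: s ls => [|j s IH] ls.
  have := act_linl (-1) DL_sub.1 DL_sub.1 Gw.
  by rewrite !big_nil !scaleN1r !addNr.
have lj := ls j (mem_head _ _).
have ls' : forall j', j' \in s -> DL (l j').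
  by move=> j' j's; apply: ls; rewrite inE j's orbT.
rewrite !big_cons -IH // -[l j]scale1r act_linl ?scale1r //.
exact: subspace_sum.
Qed.

Lemma ext_act_commutator i (z : hom_tower Y X i) : in_tower step z ->
  stable_on DL (commutator_ext step ad z) /\
  forall l w, DL l -> G w -> act (commutator_ext step ad z l) w =
    commutator (commutator_ext step E z) (act l) w.
Proof.
elim: i z => [|i IH] z.
  by move=> _; split=> [|l w]; [exact: ad_stable|exact: act_ad].
move=> /decompositionP[]; set s := xget _ _ => sP zE.
pose e t := commutator_ext step ad (t : X * hom_tower Y X i).2.
pose C t := commutator_ext step E (t : X * hom_tower Y X i).2.
have adzE l : commutator_ext step ad z l =
    \sum_(t <- s) (ad t.1 (e t l) - e t (ad t.1 l)).
  by [].
have EzE w : commutator_ext step E z w =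
    \sum_(t <- s) (E t.1 (C t w) - C t (E t.1 w)).
  by [].
have tP t : t \in s -> [/\ stable_on DL (e t), stable_on G (C t), linear (C t) &
    forall l w, DL l -> G w -> act (e t l) w = commutator (C t) (act l) w].
  move=> /sP tt; have [est eact] := IH _ tt.
  by split=> //; [exact: extE_stable|exact: extE_lin].
have term_DL t l : t \in s -> DL l -> DL (ad t.1 (e t l) - e t (ad t.1 l)).
  move=> /tP[est _ _ _] lD; apply: subspaceB => //.
    by apply: ad_stable; exact: est.
  by apply: est; exact: ad_stable.
split=> [l lD|l w lD Gw].
  by rewrite adzE; apply: subspace_sum => // t /term_DL; exact.
rewrite adzE act_sum //; last by move=> t /term_DL; exact.
rewrite /commutator !EzE (lin_sum (act_linr lD)) -sumrB big_seq [RHS]big_seq.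
apply: eq_bigr => t ts; have [est Cst Clin eact] := tP t ts.
have el := est _ lD; have adl : DL (ad t.1 l) by exact: ad_stable.
have ael : DL (ad t.1 (e t l)) by exact: ad_stable.
have eal : DL (e t (ad t.1 l)) by exact: est.
have -> : act (ad t.1 (e t l) - e t (ad t.1 l)) w =
    act (ad t.1 (e t l)) w - act (e t (ad t.1 l)) w.
  by rewrite addrC -scaleN1r act_linl // scaleN1r addrC.
(* What remains is [E,[C,T]] - [C,[E,T]] = [[E,C],T] for the operator T of l. *)
rewrite act_ad // eact // /commutator.
rewrite !eact ?act_ad //; try exact: E_stable; try exact: Cst.
rewrite /commutator !(linB Clin) !(linB (E_lin _)) !(linB (act_linr lD)); abel.
Qed.
End CommutatorExtensions.

(** * The operators of homogeneous elements of L on the positive extension *)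

Section PositiveExtensionModule.
Variables (k : fieldType) (P : standardPentad k).
Local Notation g := (pg P).
Local Notation V := (pV P).
Local Notation dual := (pdual P).
Local Notation rho := (@prho k P).
Local Notation varrho := (@pvarrho k P).
Variables (U : lmodType k) (pi : g -> U -> U).
Hypothesis pi_rep : is_representation pi.

Local Notation L := (Lambient P).
Local Notation W := (Uambient P U).
Local Notation A := (act_zero pi).
Local Notation E := (act_pos pi).
Local Notation F := (@act_neg k P U).
Local Notation r := (@r_map k P U pi).
Local Notation G := [set w : W | forall m, in_tower r (w m)].
Local Notation op := (graded_ext A E F).
Local Notation ad := (graded_ext (@ad_zero k P) (@ad_pos k P) (@ad_neg k P)).
Local Notation grade := (@Lgrade k P).

(** Level i of a tower holds the elements of degree i+1, or -(i+1) in the negative half. *)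
Definition positive_degree i := @has_degree k (Uspace P U) i.+1%:Z.
Definition negative_degree i := @has_degree k (Uspace P U) (- i.+1%:Z).

Lemma positive_extP : extension_laws (@p_map k P)
  (tower_act rho varrho) G A E F positive_degree.
Proof.
apply: (commutator_extP (c := @ev_pos k P) (aX := rho) (aY := varrho)
  (act := tower_act rho varrho)) => //.
- exact: Ugraded_subspace.
- exact: act_zero_lin.
- exact: act_pos_lin.
- exact: act_zero_stable.
- exact: act_pos_stable.
- exact: act_neg_stable.
- exact: act_pos_linl.
- by move=> a x w Gw; exact: act_zero_pos.
- by move=> a y w _; exact: act_zero_neg.
- by move=> x y w Gw; exact: act_pos_neg.
- by move=> i e S T; exact: has_degree_comb.
- by move=> x; exact: act_pos_degree.
- move=> i a T Td; apply: has_degree_commutator (act_zero_degree pi_rep _) Td.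
  by rewrite add0r.
- move=> i x T _ Td; apply: has_degree_commutator (act_pos_degree pi_rep _) Td.
  by rewrite -PoszD.
- move=> i y T _ Td; apply: has_degree_commutator Td (act_neg_degree _).
  by rewrite -addn1 PoszD addrK.
- by move=> i T _ _; exact: positive_faithful.
- exact: p_tow_subspace.
- by move=> i z a zt; exact: tl_act_stable (p_levelP zt) a.
- by move=> i z y zt; exact: (tl_eval (p_levelP zt)).2.
Qed.

Lemma negative_extP : extension_laws (@q_map k P)
  (tower_act varrho rho) G A F E negative_degree.
Proof.
apply: (commutator_extP (c := @ev_neg k P) (aX := varrho) (aY := rho)
  (act := tower_act varrho rho)) => //.
- exact: Ugraded_subspace.
- exact: act_zero_lin.
- exact: act_pos_lin.
- exact: act_zero_stable.
- exact: act_neg_stable.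
- exact: act_pos_stable.
- exact: act_neg_linl.
- by move=> a y w _; exact: act_zero_neg.
- by move=> a x w Gw; exact: act_zero_pos.
(* The sign in y(x) = -x(y) accounts for the exchange of E and F in the commutator. *)
- move=> y x w Gw; rewrite -[LHS]opprB -[X in - X]/(commutator (E x) (F y) w).
  by rewrite act_pos_neg // /ev_neg (linN (act_zero_linl pi_rep Gw)).
- by move=> i e S T; exact: has_degree_comb.
- by move=> y; exact: act_neg_degree.
- move=> i a T Td; apply: has_degree_commutator (act_zero_degree pi_rep _) Td.
  by rewrite add0r.
- move=> i y T _ Td; apply: has_degree_commutator (act_neg_degree _) Td.
  by rewrite -opprD -PoszD.
- move=> i x T _ Td; apply: has_degree_commutator Td (act_pos_degree pi_rep _).
  by rewrite -[i.+2]addn1 PoszD opprD subrK.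
- by move=> i T Tl _; exact: (negative_faithful pi_rep).
- exact: q_tow_subspace.
- by move=> i z a zt; exact: tl_act_stable (q_levelP zt) a.
- by move=> i z y zt; exact: (tl_eval (q_levelP zt)).2.
Qed.

Lemma op_linear n (z : Lspace P n) : grade z -> linear (op z).
Proof.
case: n z => [[|i]|i] z zn; first exact: act_zero_lin.
  by have [] := el_admissible positive_extP zn.
by have [] := el_admissible negative_extP zn.
Qed.

Lemma op_stable n (z : Lspace P n) : grade z -> stable_on G (op z).
Proof.
case: n z => [[|i]|i] z zn; first exact: act_zero_stable.
  by have [] := el_admissible positive_extP zn.
by have [] := el_admissible negative_extP zn.
Qed.

Lemma op_degree n (z : Lspace P n) : grade z -> has_degree n (op z).
Proof.
case: n z => [[|i]|i] z zn; first exact: act_zero_degree.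
  by have [] := el_admissible positive_extP zn.
by have [] := el_admissible negative_extP zn.
Qed.

Lemma op_linl n e (z z' : Lspace P n) w : grade z -> grade z' -> G w ->
  op (e *: z + z') w = e *: op z w + op z' w.
Proof.
case: n z z' => [[|i]|i] z z' zn z'n Gw; first exact: (act_zero_linl pi_rep Gw).
  exact: (el_linl positive_extP).
exact: (el_linl negative_extP).
Qed.

Lemma grade_subspace n : subspace (@Lgrade k P n).
Proof.
case: n => [[|i]|i]; first by split.
  exact: p_tow_subspace.
exact: q_tow_subspace.
Qed.

(** The decomposition chosen for 0 need not be empty, so this comes from linearity and is obtained
    on G only. *)
Lemma op0 n w : G w -> op (0 : Lspace P n) w = 0.
Proof.
move=> Gw; have g0 := (grade_subspace n).1.
by have := op_linl (-1) g0 g0 Gw; rewrite !scaleN1r !addNr.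
Qed.

Lemma opN n (z : Lspace P n) w : grade z -> G w -> op (- z) w = - op z w.
Proof.
move=> zn Gw; have := op_linl (-1) zn (grade_subspace n).1 Gw.
by rewrite addr0 op0 // addr0 !scaleN1r.
Qed.

(** * Brackets by elements of degree 0, 1 and -1 *)

Local Notation graded w := (forall n, grade (w n)).

Lemma ad_zero_graded a (w : L) : graded w -> graded (ad_zero a w).
Proof.
move=> wg [[|i]|i] //; first exact: tl_act_stable (p_levelP (wg i.+1)) a.
exact: tl_act_stable (q_levelP (wg (Negz i))) a.
Qed.

Lemma ad_pos_graded x (w : L) : graded w -> graded (ad_pos x w).
Proof.
move=> wg [[|[|i]]|i] //; first by apply: step_in_tower; exact: (wg i.+1).
apply: (subspaceN (q_tow_subspace P i)).
exact: (tl_eval (q_levelP (wg (Negz i.+1)))).2.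
Qed.

Lemma ad_neg_graded y (w : L) : graded w -> graded (ad_neg y w).
Proof.
move=> wg [[|i]|[|i]] //; last by apply: step_in_tower; exact: (wg (Negz i)).
apply: (subspaceN (p_tow_subspace P i)).
exact: (tl_eval (p_levelP (wg i.+2))).2.
Qed.

(** Subtraction of 1 by cases on the constructors, so that the types [Lspace] of the shifted
    components reduce by computation. *)
Definition pred_int (n : int) : int :=
  match n with
  | Posz 0 => Negz 0
  | Posz i.+1 => Posz i
  | Negz i => Negz i.+1
  end.

Definition succ_int (n : int) : int :=
  match n with
  | Posz i => Posz i.+1
  | Negz 0 => Posz 0
  | Negz i.+1 => Negz i
  end.

Lemma pred_intK : cancel pred_int succ_int.
Proof. by case=> [[|i]|i]. Qed.

Lemma succ_intK : cancel succ_int pred_int.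
Proof. by case=> [i|[|i]]. Qed.

Lemma op_ad_zero a (w : L) n v : graded w -> G v ->
  op (ad_zero a w n) v = commutator (A a) (op (w n)) v.
Proof.
move=> wg Gv; case: n => [[|i]|i].
- exact: act_zero_br.
- exact: (el_act positive_extP a (wg i.+1)).
- exact: (el_act negative_extP a (wg (Negz i))).
Qed.

(** Component n of [x,w] comes from component n-1 of w. The cases are [E,F] for n = 0, [A,E] for n =
    1, the step law above and the evaluation law in negative degrees. *)
Lemma op_ad_pos x (w : L) n v : graded w -> G v ->
  op (ad_pos x w n) v = commutator (E x) (op (w (pred_int n))) v.
Proof.
move=> wg Gv; case: n => [[|[|i]]|i].
- rewrite -[LHS]/(A (- - ev_pos x (w (Negz 0))) v) opprK -act_pos_neg //.
- rewrite -[LHS]/(E (- rho (w 0) x) v) (linN (act_pos_linl pi_rep Gv)).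
  by rewrite -act_zero_pos // opprB.
- exact: (el_step positive_extP x (wg i.+1)).
- have wt := wg (Negz i.+1); have wxt := (tl_eval (q_levelP wt)).2 x.
  rewrite -[LHS]/(op (- ((w (Negz i.+1) : V -> Lspace P (Negz i)) x)) v) opN //.
  by rewrite -[RHS]opprB; congr (- _); exact: (el_eval negative_extP).
Qed.

Lemma op_ad_neg y (w : L) n v : graded w -> G v ->
  op (ad_neg y w n) v = commutator (F y) (op (w (succ_int n))) v.
Proof.
move=> wg Gv; case: n => [[|i]|[|i]].
- rewrite -[LHS]/(A (- ev_pos (w 1) y) v) (linN (act_zero_linl pi_rep Gv)).
  by rewrite -act_pos_neg // opprB.
- have wt := wg (Posz i.+2); have wyt := (tl_eval (p_levelP wt)).2 y.
  rewrite -[LHS]/(op (- (w (Posz i.+2) : dual -> Lspace P (Posz i.+1)) y) v).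
  rewrite opN //.
  by rewrite -[RHS]opprB; congr (- _); exact: (el_eval positive_extP).
- rewrite -[LHS]/(F (- varrho (w 0) y) v) (linN (act_neg_linl pi_rep Gv)).
  by rewrite -(act_zero_neg pi) opprB.
- exact: (el_step negative_extP y (wg (Negz i))).
Qed.

(** This and the next two lemmas bound the support of a bracket by a shift of that of w, which gives
    finiteness and the covering lists. *)
Lemma ad_zero_eq0 a (w : L) n : w n = 0 -> ad_zero a w n = 0.
Proof.
case: n => [[|i]|i] w0.
- by rewrite -[LHS]/(lie_bracket g a (w 0)) w0 linear0.
- rewrite -[LHS]/(tower_act rho varrho a (w (Posz i.+1))) w0.
  exact: (lin0 (@p_act_linr k P i a)).
- rewrite -[LHS]/(tower_act varrho rho a (w (Negz i))) w0.
  exact: (lin0 (@q_act_linr k P i a)).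
Qed.

Lemma ad_pos_eq0 x (w : L) n : w (pred_int n) = 0 -> ad_pos x w n = 0.
Proof.
case: n => [[|[|i]]|i] w0.
- rewrite -[LHS]/(- - ev_pos x (w (Negz 0))) opprK w0;
  exact: (lin0 (ev_pos_linr x)).
- rewrite -[LHS]/(- rho (w 0) x) w0 (lin0 (rep_linl (@prho_rep k P) x)).
  exact: oppr0.
- rewrite -[LHS]/(p_map x (w (Posz i.+1))) w0;
  exact: (lin0 (@p_map_linr k P i x)).
- rewrite -[LHS]/(- (w (Negz i.+1) : V -> Lspace P (Negz i)) x) w0.
  exact: oppr0.
Qed.

Lemma ad_neg_eq0 y (w : L) n : w (succ_int n) = 0 -> ad_neg y w n = 0.
Proof.
case: n => [[|i]|[|i]] w0.
- rewrite -[LHS]/(- ev_pos (w 1) y) w0 (lin0 (ev_pos_linl y)); exact: oppr0.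
- rewrite -[LHS]/(- (w (Posz i.+2) : dual -> Lspace P (Posz i.+1)) y) w0.
  exact: oppr0.
- rewrite -[LHS]/(- varrho (w 0) y) w0 (lin0 (rep_linl (varrho_rep P) y)).
  exact: oppr0.
- rewrite -[LHS]/(q_map y (w (Negz i))) w0; exact: (lin0 (@q_map_linr k P i y)).
Qed.

(** * Linearity, bracket compatibility and grading of the action *)

Local Notation DL := (direct_sum (@Lgrade k P)).
Local Notation ext := (@positive_extension k P U pi).

Lemma Ldirect_sum_subspace : subspace DL.
Proof. by apply: direct_sum_subspace => n; exact: grade_subspace. Qed.

Lemma ad_zero_stable a : stable_on DL (@ad_zero k P a).
Proof.
move=> w [wg finw]; split; first exact: ad_zero_graded.
apply: sub_finite_set finw => n /=; apply: contra_neq; exact: ad_zero_eq0.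
Qed.

Lemma ad_pos_stable x : stable_on DL (@ad_pos k P x).
Proof.
move=> w [wg finw]; split; first exact: ad_pos_graded.
apply: sub_finite_set (finite_image succ_int finw) => n /= n0.
exists (pred_int n); last exact: pred_intK.
by apply: contra_neq n0; exact: ad_pos_eq0.
Qed.

Lemma ad_neg_stable y : stable_on DL (@ad_neg k P y).
Proof.
move=> w [wg finw]; split; first exact: ad_neg_graded.
apply: sub_finite_set (finite_image pred_int finw) => n /= n0.
exists (succ_int n); last exact: succ_intK.
by apply: contra_neq n0; exact: ad_neg_eq0.
Qed.

Lemma ext_covers s z u : covers s z -> G u ->
  ext z u = \sum_(n <- s) op (z n) u.
Proof. by move=> sz Gu; apply: covers_fsbig sz _ => n ->; exact: op0. Qed.

Lemma ext_linear z : DL z -> linear (ext z).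
Proof.
(* Since u and v need not lie in G, where [op0] is available, the list has to be the exact support
   of z. *)
move=> [zg /coversP[s _ sE]] e u v; rewrite /positive_extension !sE.
rewrite scaler_sumr -big_split; apply: eq_bigr => n _; exact: op_linear.
Qed.

Lemma ext_linl e z z' u : DL z -> DL z' -> G u ->
  ext (e *: z + z') u = e *: ext z u + ext z' u.
Proof.
move=> [zg /coversP[s sz _]] [z'g /coversP[s' sz' _]] Gu.
(* The supports of the three elements differ, so all sums are taken over one list covering both
   supports. *)
have c f : (forall n, f n != 0 -> (n \in s) || (n \in s')) ->
    covers (undup (s ++ s')) f.
  by move=> fs; split=> [|n /fs]; rewrite ?undup_uniq ?mem_undup ?mem_cat.
rewrite !(@ext_covers (undup (s ++ s'))) //.
- rewrite scaler_sumr -big_split; apply: eq_bigr => n _; exact: op_linl.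
- by apply: c => n /sz'.2 ->; rewrite orbT.
- by apply: c => n /sz.2 ->.
apply: c => n; apply: contra_neqT; rewrite negb_or => /andP[ns ns'].
have /eqP zn : z n == 0 by apply: contraNT ns; exact: sz.2.
have /eqP z'n : z' n == 0 by apply: contraNT ns'; exact: sz'.2.
by rewrite -[LHS]/(e *: z n + z' n) zn z'n scaler0 addr0.
Qed.

Lemma ext_ad_zero a w u : DL w -> G u ->
  ext (ad_zero a w) u = commutator (A a) (ext w) u.
Proof.
move=> [wg /coversP[s sw _]] Gu.
have Au := act_zero_stable pi_rep a Gu.
have sc : covers s (ad_zero a w).
  split=> [|n n0]; first exact: sw.1.
  by apply: sw.2; apply: contra_neq n0; exact: ad_zero_eq0.
rewrite /commutator !(ext_covers sw) // (ext_covers sc) //.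
rewrite (lin_sum (act_zero_lin pi_rep a)).
by rewrite -sumrB; apply: eq_bigr => n _; exact: op_ad_zero.
Qed.

Lemma ext_ad_pos x w u : DL w -> G u ->
  ext (ad_pos x w) u = commutator (E x) (ext w) u.
Proof.
move=> [wg /coversP[s sw _]] Gu.
have Eu := act_pos_stable x Gu.
have sc : covers (map succ_int s) (ad_pos x w).
  split=> [|n n0].
    by rewrite (map_inj_uniq (can_inj succ_intK)); exact: sw.1.
  rewrite -[n]pred_intK; apply/map_f/sw.2.
  by apply: contra_neq n0; exact: ad_pos_eq0.
rewrite /commutator !(ext_covers sw) // (ext_covers sc) //.
rewrite (lin_sum (act_pos_lin pi_rep x)).
rewrite -sumrB big_map; apply: eq_bigr => n _.
by rewrite op_ad_pos // succ_intK.
Qed.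

Lemma ext_ad_neg y w u : DL w -> G u ->
  ext (ad_neg y w) u = commutator (F y) (ext w) u.
Proof.
move=> [wg /coversP[s sw _]] Gu.
have Fu := act_neg_stable pi_rep y Gu.
have sc : covers (map pred_int s) (ad_neg y w).
  split=> [|n n0].
    by rewrite (map_inj_uniq (can_inj pred_intK)); exact: sw.1.
  rewrite -[n]succ_intK; apply/map_f/sw.2.
  by apply: contra_neq n0; exact: ad_neg_eq0.
rewrite /commutator !(ext_covers sw) // (ext_covers sc) //.
rewrite (lin_sum (act_neg_lin y)).
rewrite -sumrB big_map; apply: eq_bigr => n _.
by rewrite op_ad_neg // pred_intK.
Qed.

Lemma ext_ad n (z : Lspace P n) : grade z ->
  stable_on DL (ad z) /\
  forall w u, DL w -> G u -> ext (ad z w) u = commutator (op z) (ext w) u.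
Proof.
case: n z => [[|i]|i] z zn.
- by split=> [|w u Dw Gu]; [exact: ad_zero_stable|exact: ext_ad_zero].
- apply: ext_act_commutator zn.
  + exact: Ldirect_sum_subspace.
  + by move=> e l l' w Dl Dl' Gw; exact: ext_linl.
  + exact: ext_linear.
  + exact: act_pos_stable.
  + exact: act_pos_lin.
  + exact: ad_pos_stable.
  + by move=> x l w Dl Gw; exact: ext_ad_pos.
  + by move=> j z' zt; exact: (@op_stable (Posz j.+1)).
  + by move=> j z' zt; exact: (@op_linear (Posz j.+1)).
- apply: ext_act_commutator zn.
  + exact: Ldirect_sum_subspace.
  + by move=> e l l' w Dl Dl' Gw; exact: ext_linl.
  + exact: ext_linear.
  + exact: act_neg_stable.
  + exact: act_neg_lin.
  + exact: ad_neg_stable.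
  + by move=> x l w Dl Gw; exact: ext_ad_neg.
  + by move=> j z' zt; exact: (@op_stable (Negz j)).
  + by move=> j z' zt; exact: (@op_linear (Negz j)).
Qed.

(** Both sides are sums over the homogeneous components of z, which reduces the claim to
    [ext_ad]. *)
Lemma ext_bracket z w u : DL z -> DL w -> G u ->
  ext (Lbracket z w) u = commutator (ext z) (ext w) u.
Proof.
move=> [zg /coversP[s sz sE]] Dw Gu; rewrite /Lbracket sE.
have term n : DL (ad (z n) w) by apply: (ext_ad (zg n)).1.
have zE v : ext z v = \sum_(n <- s) op (z n) v by exact: sE.
rewrite (act_sum Ldirect_sum_subspace ext_linl) // /commutator !zE.
rewrite (lin_sum (ext_linear Dw)).
rewrite -sumrB; apply: eq_bigr => n _.
exact: (ext_ad (zg n)).2.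
Qed.

Local Notation DU := (direct_sum (@Ugrade k P U pi)).

Lemma ext_direct_sum z u : DL z -> DU u -> DU (ext z u).
Proof.
move=> [zg /coversP[s _ sE]] [Gu finu]; rewrite /positive_extension sE.
apply: subspace_sum.
  by apply: direct_sum_subspace; exact: (r_tow_subspace pi_rep).
move=> n _; split; first exact: op_stable.
exact: has_degree_finite (op_degree (zg n)) finu.
Qed.

Lemma ext_homogeneous n m z u :
  homogeneous (@Lgrade k P) n z -> homogeneous (@Ugrade k P U pi) m u ->
  forall j : nat, n + m%:Z != j%:Z -> ext z u j = 0.
Proof.
move=> zn um j nmj.
have Gu : G u.
  exact: (homogeneous_direct_sum (r_tow_subspace pi_rep) um).1.
(* The singleton list also covers z when z = 0. *)
have sz : covers [:: n] z.
  by split=> // i; rewrite inE; apply: contraNT => /zn.2 ->.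
rewrite (ext_covers sz) // big_seq1; apply: op_degree zn.1 _ _ _ => m' m'j.
by apply: um.2; apply: contra_neq nmj => <-; rewrite addrC.
Qed.
End PositiveExtensionModule.

Theorem theorem3p12 (k : fieldType) (P : standardPentad k) (U : lmodType k)
    (pi : pg P -> U -> U) (pi_rep : is_representation pi) :
  is_positively_graded_module (@Lgrade k P) (@Lbracket k P)
    (@Ugrade k P U pi) (@positive_extension k P U pi).
Proof.
split; first split.
- by move=> z u Dz Du; exact: ext_direct_sum.
- by move=> e z z' u Dz Dz' [Gu _]; exact: ext_linl.
- by move=> e z u u' Dz _ _; exact: ext_linear.
- by move=> z w u Dz Dw [Gu _]; exact: ext_bracket.
move=> n m z u zn um; have z0 := ext_homogeneous pi_rep zn um.
have Dz := homogeneous_direct_sum (grade_subspace P) zn.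
have Du := homogeneous_direct_sum (r_tow_subspace pi_rep) um.
(* When n + m is negative, no component can carry this degree, so all of them vanish. *)
case nm: (n + m%:Z) z0 => [j|j] z0.
  split=> [|i ij]; first exact: (ext_direct_sum pi_rep Dz Du).1.
  by apply: z0; rewrite eqz_nat eq_sym.
by apply/functional_extensionality_dep => i; exact: z0.
Qed.
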